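(* Let $k$ be a commutative domain, let $n\geq 2$, and let $q\in k^{\times}$ be a primitive $n$-th root of unity. Let $A_q$ be the $k$-algebra generated by $x$ and $y$ subject to the relation $yx=qxy+1$, and let $Z(A_q)$ be its center. Then the discriminant of $A_q$ over $Z(A_q)$ is $$d(A_q/Z(A_q)) = c\,(nm)^{n^2}\bigl((1-q)^n x^n y^n-1\bigr)^{n(n-1)},$$ where $c$ is some element of $k^{\times}$ and $m=\prod_{i=2}^{n-1}(1+q+\cdots+q^{i-1})$ (with the convention $m=1$ when $n=2$).
   Context: Discriminant: let $A$ be an algebra and $Z\subseteq A$ a central subalgebra such that $A$ is a free $Z$-module of finite rank $r$. Embed $A$ into $\mathrm{End}(A_Z)\cong M_{r\times r}(Z)$ by sending $a$ to left multiplication by $a$, and let $\mathrm{tr}:A\to Z$ be the composite with the usual matrix trace. If $\{z_1,\dots,z_r\}$ is a $Z$-basis of $A$, the discriminant is $d(A/Z)=\det(\mathrm{tr}(z_iz_j))_{r\times r}\in Z$; it is well defined up to multiplication by an element of $Z^{\times}$. Here $Z(A_q)=k[x^n,y^n]$, and $A_q$ is free over $Z(A_q)$ with basis $\{x^iy^j\mid 0\leq i,j\leq n-1\}$. For a ring $R$, $R^{\times}$ denotes its group of invertible elements. *)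

(* Defs.v *)
From HB Require Import structures.
From mathcomp Require Import all_boot all_algebra.
From mathcomp Require Import boolp classical_sets.
From mathcomp Require Import finmap.
From mathcomp.multinomials Require Import monalg.

Set Implicit Arguments.
Unset Strict Implicit.
Unset Printing Implicit Defensive.

Import GRing.Theory.
Local Open Scope ring_scope.
Local Open Scope quotient_scope.

(* The free k-algebra on two letters: the monoid algebra of the free monoid
   on bool, the letter false standing for x and true for y. *)
Definition free2 (k : comNzRingType) := {malg k[{fmonom bool}]}.

HB.instance Definition _ k := GRing.Lalgebra.on (free2 k).

Definition free_x k : free2 k := << fmu false >>.
Definition free_y k : free2 k := << fmu true >>.

Definition qweyl_rel (k : comNzRingType) (q : k) : free2 k :=
  free_y k * free_x k - (q *: (free_x k * free_y k) + 1).

Definition qweyl_ideal (k : comNzRingType) (q : k) : {pred free2 k} :=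
  fun a => `[< exists s : seq (free2 k * free2 k),
                 a = \sum_(p <- s) p.1 * qweyl_rel q * p.2 >].

Section Ideal.
Variables (k : comNzRingType) (q : k).
Local Notation F := (free2 k).
Local Notation I := (qweyl_ideal q).

Lemma qweyl_ideal_zmod_closed : zmod_closed I.
Proof.
split=> [|a b /asboolP[s ->] /asboolP[t ->]]; apply/asboolP.
  by exists [::]; rewrite big_nil.
exists (s ++ [seq (- p.1, p.2) | p <- t]).
by rewrite big_cat big_map -sumrN; congr (_ + _); apply: eq_bigr => p _;
  rewrite !mulNr.
Qed.

HB.instance Definition _ :=
  GRing.isZmodClosed.Build F I qweyl_ideal_zmod_closed.

Lemma qweyl_idealMl (a b : F) : b \in I -> a * b \in I.
Proof.
move=> /asboolP[s ->]; apply/asboolP; exists [seq (a * p.1, p.2) | p <- s].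
by rewrite big_map mulr_sumr; apply: eq_bigr => p _; rewrite !mulrA.
Qed.

Lemma qweyl_idealMr (a b : F) : b \in I -> b * a \in I.
Proof.
move=> /asboolP[s ->]; apply/asboolP; exists [seq (p.1, p.2 * a) | p <- s].
by rewrite big_map mulr_suml; apply: eq_bigr => p _; rewrite !mulrA.
Qed.

Lemma free2_scalerAr (c : k) (a b : F) : c *: (a * b) = a * (c *: b).
Proof.
rewrite -!mul_malgC !mulrA; congr (_ * b); rewrite mul_malgC.
apply/malgP => w; rewrite mcoeffZ malgM_def fgmulgU /=.
rewrite raddf_sum /= {1}(monalgE a) raddf_sum mulr_sumr /=.
by apply: eq_bigr => v _; rewrite mulm1 !mcoeffU -mulrnAr mulrC mulrnAl mulrnAr.
Qed.

(* The ideal is proper: x and y act on k[X] by multiplication by X and by the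
   q-derivative. *)
Definition qnat (i : nat) : k := \sum_(j < i) q ^+ j.

Definition qderiv (p : {poly k}) : {poly k} :=
  \poly_(i < size p) (qnat i.+1 * p`_i.+1).

Lemma coef_qderiv p i : (qderiv p)`_i = qnat i.+1 * p`_i.+1.
Proof.
rewrite coef_poly; case: ltnP => // le_p_i.
by rewrite nth_default ?mulr0 // (leq_trans le_p_i).
Qed.

Definition act_letter (b : bool) (p : {poly k}) : {poly k} :=
  if b then qderiv p else 'X * p.

Lemma act_letter_is_linear b : linear (act_letter b).
Proof.
move=> c u v; rewrite /act_letter; case: b; last first.
  by rewrite mulrDr scalerAr.
apply/polyP => i; rewrite coefD coefZ !coef_qderiv coefD coefZ mulrDr.
by rewrite mulrCA.
Qed.

HB.instance Definition _ b :=
  GRing.isLinear.Build k {poly k} {poly k} *:%R (act_letter b)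
    (act_letter_is_linear b).

Definition act_word (w : seq bool) (p : {poly k}) : {poly k} :=
  foldr act_letter p w.

Lemma act_word_is_linear w : linear (act_word w).
Proof.
by move=> c u v; elim: w => //= b w ->; rewrite linearD linearZ.
Qed.

HB.instance Definition _ w :=
  GRing.isLinear.Build k {poly k} {poly k} *:%R (act_word w)
    (act_word_is_linear w).

Definition act (g : F) (p : {poly k}) : {poly k} :=
  mmap (@polyC k) (fun w : {fmonom bool} => act_word w p) g.

Lemma actU (c : k) (w : {fmonom bool}) p :
  act << c *g w >> p = c *: act_word w p.
Proof. by rewrite /act mmapU mul_polyC. Qed.

Lemma actB (g h : F) p : act (g - h) p = act g p - act h p.
Proof. by rewrite /act raddfB. Qed.

Lemma actD (g h : F) p : act (g + h) p = act g p + act h p.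
Proof. by rewrite /act raddfD. Qed.

Lemma act_sum (T : Type) (s : seq T) (f : T -> F) p :
  act (\sum_(i <- s) f i) p = \sum_(i <- s) act (f i) p.
Proof. by rewrite /act raddf_sum. Qed.

Lemma actE (g : F) p : act g p = \sum_(w <- msupp g) g@_w *: act_word w p.
Proof. by rewrite /act mmapE; apply: eq_bigr => w _; rewrite mul_polyC. Qed.

Lemma actM (g h : F) p : act (g * h) p = act g (act h p).
Proof.
rewrite malgME act_sum [RHS]actE; apply: eq_bigr => v _.
rewrite act_sum (actE h) linear_sum /= scaler_sumr; apply: eq_bigr => w _.
rewrite actU linearZ /= scalerA; congr (_ *: _).
by rewrite /mmul /= fmmulE /act_word foldr_cat.
Qed.

Lemma act1 p : act 1 p = p.
Proof. by rewrite actU scale1r fm1. Qed.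

Lemma actZ c (g : F) p : act (c *: g) p = c *: act g p.
Proof. by rewrite -mul_malgC actM actU fm1. Qed.

Lemma act0r (g : F) : act g 0 = 0.
Proof. by rewrite actE big1 // => w _; rewrite linear0 scaler0. Qed.

Lemma act_rel p : act (qweyl_rel q) p = 0.
Proof.
rewrite /qweyl_rel actB actD actZ act1 !actM !actU !scale1r !fmuE /=.
apply/polyP => i; rewrite coefB coefD coefZ !coef_qderiv !coefXM coef0 /=.
have -> : qnat i.+1 = 1 + q * qnat i.
  rewrite /qnat big_ord_recl mulr_sumr; congr (_ + _).
  by apply: eq_bigr => j _; rewrite -exprS.
case: i => [|i] /=.
  by rewrite /qnat big_ord0 !mulr0 addr0 mul1r add0r subrr.
by rewrite coef_qderiv mulrDl mul1r mulrA [_ + p`__]addrC subrr.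
Qed.

Lemma qweyl_ideal_proper : 1 \notin I.
Proof.
apply/asboolPn => -[s s1]; have /eqP := act1 1; apply/negP.
rewrite s1 act_sum big1 => [|a _]; first by rewrite eq_sym oner_neq0.
by rewrite !actM act_rel act0r.
Qed.

End Ideal.

(* A_q = k<x, y> / (yx - qxy - 1); the library only puts a ring structure on
   quotients of commutative rings. *)
Definition qweyl (k : comNzRingType) (q : k) : Type :=
  Quotient.quot (qweyl_ideal q).

Section QWeylAlgebra.
Variables (k : comNzRingType) (q : k).
Local Notation F := (free2 k).
Local Notation A := (qweyl q).

HB.instance Definition _ := GRing.Zmodule.on A.
HB.instance Definition _ := ZmodQuotient.on A.

Definition qweyl_one : A := \pi_A (1 : F).
Definition qweyl_mul (a b : A) : A := \pi_A (repr a * repr b).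
Definition qweyl_scale (c : k) (a : A) : A := \pi_A (c *: repr a).

Lemma qweyl_reprK (a : A) : \pi_A (repr a) = a.
Proof. exact: reprK. Qed.

Lemma qweyl_piE (a b : F) :
  (\pi_A a == \pi_A b) = (a - b \in qweyl_ideal q).
Proof. by rewrite piE. Qed.

Lemma qweyl_repr_pi (a : F) : repr (\pi_A a) - a \in qweyl_ideal q.
Proof. by rewrite -qweyl_piE reprK. Qed.

Lemma qweyl_piM (a b : F) : \pi_A (a * b) = qweyl_mul (\pi_A a) (\pi_A b).
Proof.
apply/esym/eqP; rewrite qweyl_piE; set a' := repr _; set b' := repr _.
have -> : a' * b' - a * b = (a' - a) * b' + a * (b' - b).
  by rewrite mulrBl mulrBr addrA subrK.
apply: rpredD; first exact/qweyl_idealMr/qweyl_repr_pi.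
exact/qweyl_idealMl/qweyl_repr_pi.
Qed.

Lemma qweyl_piZ c (a : F) : \pi_A (c *: a) = qweyl_scale c (\pi_A a).
Proof.
apply/esym/eqP; rewrite qweyl_piE -scalerBr -mul_malgC.
exact/qweyl_idealMl/qweyl_repr_pi.
Qed.

Lemma qweyl_piD (a b : F) : \pi_A (a + b) = \pi_A a + \pi_A b.
Proof. by rewrite piE. Qed.

Lemma qweyl_mulA : associative qweyl_mul.
Proof.
move=> a b c; rewrite -[a]qweyl_reprK -[b]qweyl_reprK -[c]qweyl_reprK.
by rewrite -!qweyl_piM mulrA.
Qed.

Lemma qweyl_mul1 : left_id qweyl_one qweyl_mul.
Proof. by move=> a; rewrite -[a]qweyl_reprK -qweyl_piM mul1r. Qed.

Lemma qweyl_mulr1 : right_id qweyl_one qweyl_mul.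
Proof. by move=> a; rewrite -[a]qweyl_reprK -qweyl_piM mulr1. Qed.

Lemma qweyl_mulDl : left_distributive qweyl_mul +%R.
Proof.
move=> a b c; rewrite -[a]qweyl_reprK -[b]qweyl_reprK -[c]qweyl_reprK.
by rewrite -qweyl_piD -!qweyl_piM -qweyl_piD mulrDl.
Qed.

Lemma qweyl_mulDr : right_distributive qweyl_mul +%R.
Proof.
move=> a b c; rewrite -[a]qweyl_reprK -[b]qweyl_reprK -[c]qweyl_reprK.
by rewrite -qweyl_piD -!qweyl_piM -qweyl_piD mulrDr.
Qed.

Lemma qweyl_one_neq0 : qweyl_one != 0.
Proof. by rewrite /qweyl_one piE /Quotient.equiv subr0 qweyl_ideal_proper. Qed.

HB.instance Definition _ := GRing.Zmodule_isNzRing.Build A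
  qweyl_mulA qweyl_mul1 qweyl_mulr1 qweyl_mulDl qweyl_mulDr qweyl_one_neq0.

Lemma qweyl_scaleA c d (a : A) :
  qweyl_scale c (qweyl_scale d a) = qweyl_scale (c * d) a.
Proof. by rewrite -[a]qweyl_reprK -!qweyl_piZ scalerA. Qed.

Lemma qweyl_scale1 : left_id 1 qweyl_scale.
Proof. by move=> a; rewrite -[a]qweyl_reprK -qweyl_piZ scale1r. Qed.

Lemma qweyl_scaleDr : right_distributive qweyl_scale +%R.
Proof.
move=> c a b; rewrite -[a]qweyl_reprK -[b]qweyl_reprK.
by rewrite -qweyl_piD -!qweyl_piZ -qweyl_piD scalerDr.
Qed.

Lemma qweyl_scaleDl (a : A) : {morph qweyl_scale^~ a : c d / c + d}.
Proof. by move=> c d; rewrite -[a]qweyl_reprK -!qweyl_piZ -qweyl_piD scalerDl. Qed.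

HB.instance Definition _ := GRing.Zmodule_isLmodule.Build k A
  qweyl_scaleA qweyl_scale1 qweyl_scaleDr qweyl_scaleDl.

Lemma qweyl_scalerAl c (a b : A) : c *: (a * b) = (c *: a) * b.
Proof.
change (qweyl_scale c (qweyl_mul a b) = qweyl_mul (qweyl_scale c a) b).
rewrite -[a]qweyl_reprK -[b]qweyl_reprK.
by rewrite -qweyl_piM -!qweyl_piZ -qweyl_piM scalerAl.
Qed.

HB.instance Definition _ := GRing.Lmodule_isLalgebra.Build k A qweyl_scalerAl.

Lemma qweyl_scalerAr c (a b : A) : c *: (a * b) = a * (c *: b).
Proof.
change (qweyl_scale c (qweyl_mul a b) = qweyl_mul a (qweyl_scale c b)).
rewrite -[a]qweyl_reprK -[b]qweyl_reprK.
by rewrite -qweyl_piM -!qweyl_piZ -qweyl_piM free2_scalerAr.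
Qed.

HB.instance Definition _ := GRing.Lalgebra_isAlgebra.Build k A qweyl_scalerAr.

Definition qweyl_x : A := \pi_A (free_x k).
Definition qweyl_y : A := \pi_A (free_y k).

Lemma qweylE : qweyl_y * qweyl_x = q *: (qweyl_x * qweyl_y) + 1.
Proof.
change (qweyl_mul qweyl_y qweyl_x =
        qweyl_scale q (qweyl_mul qweyl_x qweyl_y) + qweyl_one).
rewrite -!qweyl_piM -qweyl_piZ -qweyl_piD; apply/eqP; rewrite qweyl_piE.
apply/asboolP; exists [:: (1, 1)].
by rewrite big_seq1 /= mul1r mulr1.
Qed.

End QWeylAlgebra.

Section Center.
Variable A : nzRingType.

Definition central : {pred A} := fun z => `[< forall a, z * a = a * z >].

Lemma central_subring : subring_closed central.
Proof.
split; first by apply/asboolP => a; rewrite mul1r mulr1.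
  move=> z w /asboolP zP /asboolP wP; apply/asboolP => a.
  by rewrite mulrBl mulrBr zP wP.
move=> z w /asboolP zP /asboolP wP; apply/asboolP => a.
by rewrite -mulrA wP mulrA zP mulrA.
Qed.

HB.instance Definition _ := GRing.isSubringClosed.Build A central
  central_subring.

Definition center : Type := {z : A | central z}.

HB.instance Definition _ := SubChoice.on center.
HB.instance Definition _ := [SubChoice_isSubNzRing of center by <:].

Lemma centerC (z : center) (a : A) : \val z * a = a * \val z.
Proof. by have /asboolP := valP z. Qed.

Lemma center_mulC : commutative (@GRing.mul center).
Proof. by move=> z w; apply: val_inj; rewrite !rmorphM /= centerC. Qed.

HB.instance Definition _ := GRing.PzRing_hasCommutativeMul.Build center
  center_mulC.

(* A seen as an algebra over its center *)
Definition over_center : Type := A.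

HB.instance Definition _ := GRing.NzRing.on over_center.

Definition center_scale (z : center) (a : over_center) : over_center :=
  \val z * a.

Lemma center_scaleA z w a :
  center_scale z (center_scale w a) = center_scale (z * w) a.
Proof. by rewrite /center_scale mulrA -rmorphM. Qed.

Lemma center_scale1 : left_id 1 center_scale.
Proof. by move=> a; rewrite /center_scale rmorph1 mul1r. Qed.

Lemma center_scaleDr : right_distributive center_scale +%R.
Proof. by move=> z a b; rewrite /center_scale mulrDr. Qed.

Lemma center_scaleDl a : {morph center_scale^~ a : z w / z + w}.
Proof. by move=> z w; rewrite /center_scale rmorphD mulrDl. Qed.

HB.instance Definition _ := GRing.Zmodule_isLmodule.Build center over_center
  center_scaleA center_scale1 center_scaleDr center_scaleDl.

Lemma center_scalerAl (z : center) (a b : over_center) :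
  z *: (a * b) = (z *: a) * b.
Proof. exact: mulrA. Qed.

HB.instance Definition _ := GRing.Lmodule_isLalgebra.Build center over_center
  center_scalerAl.

Lemma center_scalerAr (z : center) (a b : over_center) :
  z *: (a * b) = a * (z *: b).
Proof. by rewrite /GRing.scale /= /center_scale mulrA centerC mulrA. Qed.

HB.instance Definition _ := GRing.Lalgebra_isAlgebra.Build center over_center
  center_scalerAr.

End Center.

Section Discriminant.
Variables (Z : comNzRingType) (A : algType Z).

Definition is_basis (I : finType) (b : I -> A) : Prop :=
  forall a : A, exists! c : {ffun I -> Z}, a = \sum_i c i *: b i.

Variables (r : nat) (b : 'I_r -> A).

(* meaningful only when b is a basis *)
Definition coords (a : A) : {ffun 'I_r -> Z} :=
  xget [ffun=> 0] [set c : {ffun 'I_r -> Z} | a = \sum_i c i *: b i]%classic.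

Definition lmul_mx (a : A) : 'M[Z]_r := \matrix_(i, j) coords (a * b j) i.

Definition algtr (a : A) : Z := \tr (lmul_mx a).

Definition discriminant : Z := \det (\matrix_(i, j) algtr (b i * b j)).

End Discriminant.

(* Main.v *)
Require Import Defs.
From HB Require Import structures.
From mathcomp Require Import all_boot all_algebra.
From mathcomp Require Import perm boolp classical_sets ring.
From mathcomp Require Import finmap.
From mathcomp.multinomials Require Import monalg.

(* Put omega = 1 + (q - 1) xy.  It q-commutes with x and y, and
   omega - q^l carries x^l y^l to q^l (q - 1) x^(l+1) y^(l+1); since
   prod_(i < n) (X - q^i) = X^n - 1, this gives
   omega^n = 1 - (1 - q)^n x^n y^n.
   The trace of x^i omega^j vanishes unless n divides both i and j: moving x
   or omega around the trace multiplies it by a nontrivial power of q.  Hence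
   the Gram matrix of the family x^i omega^j (i, j < n), in which
   tr 1 = n^2, is monomial.  That family is a unitriangular transform of
   prod_(i < j) (q - 1) q^i times x^(i+j) y^j, which in turn is a monomial
   transform of the basis x^i y^j.  Comparing determinants, using
   n = (1 - q)^(n-1) m, and cancelling powers of 1 - q and x^n leaves the
   formula.  The cancellation, and the fact that units of the center are
   scalars, come from the coefficients in the basis x^i y^j, which embed the
   center into k[x, y] as a ring. *)

Set Implicit Arguments.
Unset Strict Implicit.
Unset Printing Implicit Defensive.

Import GRing.Theory.
Local Open Scope ring_scope.
Local Open Scope quotient_scope.

(** * Monomials form a basis *)

Section PBW.
Variables (k : comNzRingType) (q : k).
Local Notation A := (qweyl q).
Local Notation K := {poly k}.
Local Notation x := (qweyl_x q).
Local Notation y := (qweyl_y q).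
Local Notation "[ i ]_q" := (qnat q i) (format "[ i ]_q").

Lemma qnatS i : [i.+1]_q = 1 + q * [i]_q.
Proof.
rewrite /qnat big_ord_recl mulr_sumr; congr (_ + _).
by apply: eq_bigr => j _; rewrite -exprS.
Qed.

Lemma qnat0 : [0]_q = 0. Proof. by rewrite /qnat big_ord0. Qed.

(* In k[t][x], the action of y with [t] in the role of right multiplication
   by y: y x^i = q^i x^i t + [i]_q x^(i-1). *)
Definition yact (p : {poly K}) : {poly K} :=
  \poly_(i < size p) (q ^+ i *: ('X * p`_i) + [i.+1]_q *: p`_i.+1).

Lemma coef_yact p i :
  (yact p)`_i = q ^+ i *: ('X * p`_i) + [i.+1]_q *: p`_i.+1.
Proof.
rewrite coef_poly; case: ltnP => // le_p_i.
by rewrite !nth_default ?mulr0 ?scaler0 ?addr0 // (leq_trans le_p_i).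
Qed.

Definition let_act (b : bool) (p : {poly K}) : {poly K} :=
  if b then yact p else 'X * p.

Lemma let_act_is_linear b : linear (let_act b).
Proof.
move=> c u v; rewrite /let_act; case: b; last first.
  by rewrite mulrDr scalerAr.
apply/polyP => i; rewrite coefD coefZ !coef_yact !coefD !coefZ.
by rewrite !mulrDr !scalerDr !scalerAr addrACA (mulrCA 'X).
Qed.

HB.instance Definition _ b :=
  GRing.isLinear.Build K {poly K} {poly K} *:%R (let_act b)
    (let_act_is_linear b).

Definition word_act (w : seq bool) (p : {poly K}) : {poly K} :=
  foldr let_act p w.

Lemma word_act_is_linear w : linear (word_act w).
Proof. by move=> c u v; elim: w => //= b w ->; rewrite linearD linearZ. Qed.

HB.instance Definition _ w :=
  GRing.isLinear.Build K {poly K} {poly K} *:%R (word_act w)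
    (word_act_is_linear w).

Definition free_act (g : free2 k) (p : {poly K}) : {poly K} :=
  mmap (polyC \o polyC) (fun w : {fmonom bool} => word_act w p) g.

Lemma free_actU c (w : {fmonom bool}) p :
  free_act << c *g w >> p = c%:P *: word_act w p.
Proof. by rewrite /free_act mmapU /= mul_polyC. Qed.

Lemma free_actB g h p : free_act (g - h) p = free_act g p - free_act h p.
Proof. by rewrite /free_act raddfB. Qed.

Lemma free_actD g h p : free_act (g + h) p = free_act g p + free_act h p.
Proof. by rewrite /free_act raddfD. Qed.

Lemma free_act_sum T (s : seq T) (f : T -> free2 k) p :
  free_act (\sum_(i <- s) f i) p = \sum_(i <- s) free_act (f i) p.
Proof. by rewrite /free_act raddf_sum. Qed.

Lemma free_actE g p :
  free_act g p = \sum_(w <- msupp g) (g@_w)%:P *: word_act w p.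
Proof. by rewrite /free_act mmapE; apply: eq_bigr => w _; rewrite mul_polyC. Qed.

Lemma free_act_is_linear g : linear (free_act g).
Proof.
move=> c u v; rewrite !free_actE scaler_sumr -big_split; apply: eq_bigr => w _.
by rewrite linearP scalerDr !scalerA mulrC.
Qed.

HB.instance Definition _ g :=
  GRing.isLinear.Build K {poly K} {poly K} *:%R (free_act g)
    (free_act_is_linear g).

Lemma free_actM g h p : free_act (g * h) p = free_act g (free_act h p).
Proof.
rewrite malgME free_act_sum [RHS]free_actE; apply: eq_bigr => v _.
rewrite free_act_sum (free_actE h) linear_sum /= scaler_sumr.
apply: eq_bigr => w _; rewrite free_actU linearZ /= scalerA -polyCM.
by congr (_ *: _); rewrite /mmul /= fmmulE /word_act foldr_cat.
Qed.

Lemma free_act1 p : free_act 1 p = p.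
Proof. by rewrite free_actU scale1r fm1. Qed.

Lemma free_actZ c g p : free_act (c *: g) p = c%:P *: free_act g p.
Proof. by rewrite -mul_malgC free_actM free_actU fm1. Qed.

Lemma free_act_x p : free_act (free_x k) p = 'X * p.
Proof. by rewrite free_actU fmuE scale1r. Qed.

Lemma free_act_y p : free_act (free_y k) p = yact p.
Proof. by rewrite free_actU fmuE scale1r. Qed.

(** At x^(i+1) the claim is the recursion [i+2]_q = 1 + q [i+1]_q. Once the relation acts by zero,
    so does the ideal, and the action descends to the quotient. *)
Lemma free_act_rel p : free_act (qweyl_rel q) p = 0.
Proof.
have relE g h : free_act (h * g - (q *: (g * h) + 1)) p =
    free_act h (free_act g p) - (q%:P *: free_act g (free_act h p) + p).
  by rewrite free_actB free_actD free_actZ free_act1 (free_actM h) (free_actM g).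
rewrite /qweyl_rel relE !(free_act_x, free_act_y); apply/polyP => i.
rewrite coefB coefD coefZ coef_yact !coefXM coef0 /= mul_polyC.
case: i => [|i] /=.
  by rewrite qnatS qnat0 !mulr0 addr0 !scaler0 !add0r scale1r subrr.
rewrite coef_yact scalerDr !scalerA -exprS [[i.+2]_q]qnatS scalerDl scale1r.
apply/eqP; rewrite subr_eq0 addrA; apply/eqP.
by rewrite -addrA [p`_i.+1 + _]addrC addrA.
Qed.

Lemma free_act_ideal g p : g \in qweyl_ideal q -> free_act g p = 0.
Proof.
move=> /asboolP[s ->]; rewrite free_act_sum big1 // => a _.
by rewrite !free_actM free_act_rel linear0.
Qed.

Definition qact (a : A) (p : {poly K}) := free_act (repr a) p.

Lemma qact_is_linear a : linear (qact a).
Proof. exact: linearP. Qed.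

HB.instance Definition _ a :=
  GRing.isLinear.Build K {poly K} {poly K} *:%R (qact a) (qact_is_linear a).

Lemma qact_pi g p : qact (\pi_A g) p = free_act g p.
Proof.
apply/eqP; rewrite -subr_eq0 -free_actB; apply/eqP.
exact/free_act_ideal/qweyl_repr_pi.
Qed.

Lemma qactD a b p : qact (a + b) p = qact a p + qact b p.
Proof. by rewrite -[a]qweyl_reprK -[b]qweyl_reprK -qweyl_piD !qact_pi free_actD. Qed.

Lemma qactM a b p : qact (a * b) p = qact a (qact b p).
Proof.
rewrite -[a]qweyl_reprK -[b]qweyl_reprK.
by rewrite -[_ * _]qweyl_piM !qact_pi free_actM.
Qed.

Lemma qactZ c a p : qact (c *: a) p = c%:P *: qact a p.
Proof.
by rewrite -[a]qweyl_reprK -[_ *: _]qweyl_piZ !qact_pi free_actZ.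
Qed.

Lemma qact1 p : qact 1 p = p.
Proof. by rewrite qact_pi free_act1. Qed.

Lemma qact_x p : qact x p = 'X * p.
Proof. by rewrite qact_pi free_act_x. Qed.

Lemma qact_y p : qact y p = yact p.
Proof. by rewrite qact_pi free_act_y. Qed.

End PBW.

(** Every class is a linear combination of words, and a word is built from 1 by multiplying letters
    on the left. *)
Lemma qweyl_ind (k : comNzRingType) (q : k) (P : qweyl q -> Prop) :
  P 0 -> P 1 -> (forall a b, P a -> P b -> P (a + b)) ->
  (forall c a, P a -> P (c *: a)) -> (forall a, P a -> P (qweyl_x q * a)) ->
  (forall a, P a -> P (qweyl_y q * a)) -> forall a, P a.
Proof.
move=> P0 P1 PD PZ Px Py a; rewrite -[a]qweyl_reprK (monalgE (repr a)).
have pi0 : \pi_(qweyl q) (0 : free2 k) = 0.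
  by apply: (@addIr _ (\pi_(qweyl q) 0)); rewrite -qweyl_piD !add0r.
elim/big_ind: _ => [||w _]; first by rewrite pi0.
  by move=> g h Pg Ph; rewrite qweyl_piD; apply: PD.
have -> : << (repr a)@_w *g w >> = (repr a)@_w *: (<< w >> : free2 k).
  by rewrite -mul_malgC malgM_def fgmulUU mulr1 mul1m.
rewrite qweyl_piZ; apply: PZ; case: w => w.
elim: w => [|b w IH].
  by rewrite -fmoneE; apply: P1.
have -> : << FMonom (b :: w) >> =
          (if b then free_y k else free_x k) * << FMonom w >> :> free2 k.
  have -> : FMonom (b :: w) = fmmul (fmu b) (FMonom w).
    by rewrite fmmulE fmuE.
  by case: b; rewrite malgM_def fgmulUU mulr1.
by rewrite qweyl_piM; case: b; [apply: Py | apply: Px].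
Qed.

(* [pcoef a] lists the coefficients of a in the basis x^i y^j, with x as the
   outer and y as the inner variable. *)
Record pbw_data (k : comNzRingType) (q : k) (A : algType k) (x y : A) := PBWData {
  pcoef : A -> {poly {poly k}};
  pcoef_zmod_morphism : zmod_morphism pcoef;
  pcoef1 : pcoef 1 = 1;
  pcoefZ : forall c a, pcoef (c *: a) = c%:P *: pcoef a;
  pcoef_xMl : forall a, pcoef (x * a) = 'X * pcoef a;
  pcoef_yMl : forall a, pcoef (y * a) = yact q (pcoef a);
  pcoef_yMr : forall a, pcoef (a * y) = 'X *: pcoef a;
  pbw_rel : y * x = q *: (x * y) + 1;
  pbw_ind : forall P : A -> Prop,
    P 0 -> P 1 -> (forall a b, P a -> P b -> P (a + b)) ->
    (forall c a, P a -> P (c *: a)) -> (forall a, P a -> P (x * a)) ->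
    (forall a, P a -> P (y * a)) -> forall a, P a }.

(** * Normal ordering and the inverse of [pcoef] *)

Section NormalForm.
Variables (k : comNzRingType) (q : k) (A : algType k) (x y : A).
Variable D : pbw_data q x y.
Local Notation K := {poly k}.
Local Notation "[ i ]_q" := (qnat q i) (format "[ i ]_q").
Local Notation pcoef := (pcoef D).

HB.instance Definition _ :=
  GRing.isZmodMorphism.Build A {poly K} pcoef (pcoef_zmod_morphism D).

Lemma pcoef_xnMl i a : pcoef (x ^+ i * a) = 'X^i * pcoef a.
Proof.
elim: i => [|i IH]; first by rewrite !expr0 !mul1r.
by rewrite !exprS -!mulrA pcoef_xMl IH.
Qed.

Lemma pcoef_hornerMr a (u : K) : pcoef (a * horner_alg y u) = u *: pcoef a.
Proof.
elim/poly_ind: u => [|u c IH]; first by rewrite rmorph0 mulr0 raddf0 scale0r.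
rewrite rmorphD rmorphM /= horner_algX horner_algC mulrDr mulrA raddfD /=.
by rewrite pcoef_yMr IH -scalerAr mulr1 pcoefZ scalerDl scalerA mulrC.
Qed.

Lemma horner_algZ c (u : K) : horner_alg y (c *: u) = c *: horner_alg y u.
Proof. by rewrite -mul_polyC rmorphM /= horner_algC mulr_algl. Qed.

Definition of_pcoef (p : {poly K}) : A :=
  \sum_(i < size p) x ^+ i * horner_alg y p`_i.

(** Brings sums over polynomials of different sizes to a common range, so that they can be added
    termwise. *)
Lemma of_pcoef_wide N (p : {poly K}) :
  (size p <= N)%N -> of_pcoef p = \sum_(i < N) x ^+ i * horner_alg y p`_i.
Proof.
move=> le_p_N; rewrite /of_pcoef.
rewrite (big_ord_widen N (fun i => x ^+ i * horner_alg y p`_i)) //.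
rewrite big_mkcond; apply: eq_bigr => i _; case: ltnP => // le_p_i.
by rewrite nth_default // rmorph0 mulr0.
Qed.

Lemma of_pcoefK : cancel of_pcoef pcoef.
Proof.
move=> p; rewrite raddf_sum /=.
transitivity (\sum_(i < size p) p`_i *: 'X^i); last first.
  by rewrite -poly_def coefK.
apply: eq_bigr => i _.
by rewrite pcoef_hornerMr -[x ^+ i]mulr1 pcoef_xnMl pcoef1 mulr1.
Qed.

Lemma of_pcoefD p r : of_pcoef (p + r) = of_pcoef p + of_pcoef r.
Proof.
rewrite !(@of_pcoef_wide (maxn (size p) (size r))) ?leq_maxl ?leq_maxr //.
  rewrite -big_split; apply: eq_bigr => i _.
  by rewrite coefD rmorphD mulrDr.
exact: size_polyD.
Qed.

Lemma of_pcoefZXn (u : K) i : of_pcoef (u *: 'X^i) = x ^+ i * horner_alg y u.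
Proof.
rewrite (@of_pcoef_wide i.+1); last first.
  by rewrite (leq_trans (size_scale_leq _ _)) ?size_polyXn.
rewrite big_ord_recr /= big1 ?add0r => [|j _].
  by rewrite coefZ coefXn eqxx mulr1.
by rewrite coefZ coefXn ltn_eqF // mulr0 rmorph0 mulr0.
Qed.

Lemma of_pcoef1 : of_pcoef 1 = 1.
Proof. by rewrite -[X in of_pcoef X]scale1r -(expr0 'X) of_pcoefZXn rmorph1 mulr1. Qed.

Lemma qnatSr i : [i.+1]_q = [i]_q + q ^+ i.
Proof. by rewrite /qnat big_ord_recr. Qed.

Lemma y_xn i : y * x ^+ i = q ^+ i *: (x ^+ i * y) + [i]_q *: x ^+ i.-1.
Proof.
elim: i => [|i IH].
  by rewrite qnat0 scale0r addr0 !expr0 scale1r mul1r mulr1.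
have -> : y * x ^+ i.+1 = y * x ^+ i * x by rewrite exprSr mulrA.
rewrite IH mulrDl -!scalerAl -[x ^+ i * y * x]mulrA (pbw_rel D).
rewrite mulrDr mulr1 -scalerAr scalerDr scalerA -(exprSr q).
rewrite [x ^+ i * (x * y)]mulrA -(exprSr x) -addrA /= qnatSr.
(* At i = 0 the truncated predecessor [i.-1] is 0 again, which is harmless because its coefficient
   [0]_q vanishes. *)
congr (_ + _); case: i {IH} => [|i].
  by rewrite expr0 qnat0 scale0r addr0 add0r.
by rewrite -exprSr -scalerDl addrC.
Qed.

Lemma yn_x j : y ^+ j * x = q ^+ j *: (x * y ^+ j) + [j]_q *: y ^+ j.-1.
Proof.
elim: j => [|j IH].
  by rewrite qnat0 scale0r addr0 !expr0 scale1r mul1r mulr1.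
have -> : y ^+ j.+1 * x = y * (y ^+ j * x) by rewrite exprS mulrA.
rewrite IH mulrDr -!scalerAr [y * (x * _)]mulrA (pbw_rel D).
rewrite mulrDl mul1r -scalerAl scalerDr scalerA -(exprSr q).
rewrite -[x * y * _]mulrA -(exprS y) -addrA /= qnatSr.
congr (_ + _); case: j {IH} => [|j].
  by rewrite expr0 qnat0 scale0r addr0 add0r.
by rewrite -exprS -scalerDl addrC.
Qed.

(** The normally ordered elements contain 1 and are closed under sums, scalars and left
    multiplication by x and y, so induction over A reaches everything. *)
Lemma of_pcoef_surj a : exists p, a = of_pcoef p.
Proof.
elim/(pbw_ind D): a.
- by exists 0; rewrite /of_pcoef size_poly0 big_ord0.
- by exists 1; rewrite of_pcoef1.
- by move=> _ _ [p ->] [r ->]; exists (p + r); rewrite of_pcoefD.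
- move=> c _ [p ->]; exists (c%:P *: p).
  rewrite (@of_pcoef_wide (size p) (_ *: p)) ?size_scale_leq // scaler_sumr.
  apply: eq_bigr => i _.
  by rewrite coefZ rmorphM /= horner_algC mulr_algl scalerAr.
- move=> _ [p ->]; rewrite [of_pcoef p]/of_pcoef mulr_sumr.
  elim/big_ind: _ => [||i _].
  + by exists 0; rewrite /of_pcoef size_poly0 big_ord0.
  + by move=> _ _ [r ->] [s ->]; exists (r + s); rewrite of_pcoefD.
  + by exists (p`_i *: 'X^(i.+1)); rewrite of_pcoefZXn exprS mulrA.
- move=> _ [p ->]; rewrite [of_pcoef p]/of_pcoef mulr_sumr.
  elim/big_ind: _ => [||i _].
  + by exists 0; rewrite /of_pcoef size_poly0 big_ord0.
  + by move=> _ _ [r ->] [s ->]; exists (r + s); rewrite of_pcoefD.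
  (* The witness is read off from y x^i u(y) = q^i x^i y u(y) + [i]_q x^(i-1) u(y). *)
  + exists ((q ^+ i *: ('X * p`_i)) *: 'X^i + ([i]_q *: p`_i) *: 'X^(i.-1)).
    rewrite of_pcoefD !of_pcoefZXn !horner_algZ rmorphM /= horner_algX.
    by rewrite mulrA y_xn mulrDl -!scalerAl -!scalerAr mulrA.
Qed.

Lemma pcoefK : cancel pcoef of_pcoef.
Proof. by move=> a; have [p ->] := of_pcoef_surj a; rewrite of_pcoefK. Qed.

Lemma pcoef_inj : injective pcoef.
Proof. exact: can_inj pcoefK. Qed.

Lemma pbw_expand a :
  a = \sum_(i < size (pcoef a)) \sum_(j < size (pcoef a)`_i)
        (pcoef a)`_i`_j *: (x ^+ i * y ^+ j).
Proof.
rewrite -[LHS]pcoefK; apply: eq_bigr => i _.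
rewrite -[X in horner_alg _ X]coefK poly_def rmorph_sum mulr_sumr.
by apply: eq_bigr => j _; rewrite /= horner_algZ rmorphXn /= horner_algX scalerAr.
Qed.

(* A central z moves past x^i, so multiplying by it acts separately on the two
   sides of each monomial x^i y^j. *)
Lemma pcoef_centralMl z a : (forall b, z * b = b * z) ->
  pcoef (z * a) = pcoef z * pcoef a.
Proof.
move=> zC; rewrite -[X in z * X]pcoefK mulr_sumr raddf_sum /=.
rewrite -[X in _ = _ * X]coefK poly_def mulr_sumr; apply: eq_bigr => i _.
rewrite mulrA zC -mulrA pcoef_xnMl pcoef_hornerMr.
by rewrite -scalerAr mulrC -scalerAr.
Qed.

Lemma commute_gen z : z * x = x * z -> z * y = y * z -> forall b, z * b = b * z.
Proof.
move=> zx zy; elim/(pbw_ind D).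
- by rewrite mul0r mulr0.
- by rewrite mul1r mulr1.
- by move=> a b za zb; rewrite mulrDl mulrDr za zb.
- by move=> c a za; rewrite -scalerAl -scalerAr za.
- by move=> a za; rewrite mulrA zx -mulrA za mulrA.
- by move=> a za; rewrite mulrA zy -mulrA za mulrA.
Qed.

Lemma pcoef_ynMr a j : pcoef (a * y ^+ j) = 'X^j *: pcoef a.
Proof.
elim: j => [|j IH]; first by rewrite !expr0 mulr1 scale1r.
by rewrite exprSr mulrA pcoef_yMr IH scalerA -exprS.
Qed.

Lemma coef_pcoef_monomial c s t i j :
  (pcoef (c *: (x ^+ s * y ^+ t)))`_i`_j = c *+ ((i == s) && (j == t)).
Proof.
rewrite pcoefZ pcoef_ynMr -[x ^+ s]mulr1 pcoef_xnMl pcoef1 mulr1 !coefZ coefXn.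
rewrite coefCM; case: (i == s); last by rewrite mulr0 coef0 mulr0.
by rewrite andTb mulr1 coefXn mulr_natr.
Qed.

(** Right multiplication by x is the one product with a generator not recorded in [pbw_data]. By
    additivity a monomial suffices, and there [yn_x] moves x to the left past y^t. *)
Lemma coef_pcoef_xMr a i j :
  (pcoef (a * x))`_i`_j =
  (if i is i'.+1 then q ^+ j * (pcoef a)`_i'`_j else 0)
  + [j.+1]_q * (pcoef a)`_i`_j.+1.
Proof.
rewrite [a]pbw_expand; move: (size _) => N; elim/big_ind: _ => [||s _].
- by case: i => [|i]; rewrite mul0r raddf0 /= !coef0 !mulr0 addr0.
- move=> b c IHb IHc; rewrite mulrDl !raddfD /= !coefD IHb IHc.
  by case: i {IHb IHc} => [|i]; rewrite ?coefD ?add0r !mulrDr // addrACA.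
elim/big_ind: _ => [||t _].
- by case: i => [|i]; rewrite mul0r raddf0 /= !coef0 !mulr0 addr0.
- move=> b c IHb IHc; rewrite mulrDl !raddfD /= !coefD IHb IHc.
  by case: i {IHb IHc} => [|i]; rewrite ?coefD ?add0r !mulrDr // addrACA.
move: (_ `_ t) => c; rewrite -scalerAl -mulrA yn_x mulrDr scalerDr raddfD /=.
rewrite -!scalerAr !scalerA mulrA -exprSr !coefD !coef_pcoef_monomial.
case: t => [t _] /=; congr (_ + _).
  case: i => [|i]; rewrite ?mulr0n //  coef_pcoef_monomial eqSS.
  by case: (j =P t) => [->|]; rewrite ?andbF ?mulr0n ?mulr0 // mulrC mulrnAr.
case: t => [|t].
  by rewrite /qnat big_ord0 mulr0 andbF mulr0n mulr0 mul0rn.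
by rewrite eqSS; case: (j =P t) => [->|]; rewrite ?andbF ?mulr0n ?mulr0 // mulrC mulrnAr.
Qed.

End NormalForm.

(** * The center *)

Section CenterMap.
Variables (k : comNzRingType) (q : k) (A : algType k) (x y : A).
Variable D : pbw_data q x y.

Definition in_center (z : A) (zC : forall a, z * a = a * z) : center A :=
  exist _ z (asboolT zC).

Definition scalar_center (c : k) : center A.
Proof.
by apply: (@in_center c%:A) => a; rewrite -scalerAl -scalerAr mul1r mulr1.
Defined.

Lemma scalar_center_zmod_morphism : zmod_morphism scalar_center.
Proof. by move=> c d; apply: val_inj; rewrite /= scalerBl. Qed.

HB.instance Definition _ :=
  GRing.isZmodMorphism.Build k (center A) scalar_center
    scalar_center_zmod_morphism.

Lemma scalar_center_monoid_morphism : monoid_morphism scalar_center.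
Proof.
split=> [|c d]; apply: val_inj; first exact: scale1r.
by rewrite /= -scalerAl mul1r scalerA.
Qed.

HB.instance Definition _ :=
  GRing.isMonoidMorphism.Build k (center A) scalar_center
    scalar_center_monoid_morphism.

Lemma scalar_centerM : {morph scalar_center : c d / c * d}.
Proof. exact: rmorphM. Qed.
Lemma scalar_centerX m : {morph scalar_center : c / c ^+ m}.
Proof. exact: rmorphXn. Qed.
Lemma scalar_center_nat m : scalar_center m%:R = m%:R.
Proof. exact: rmorph_nat. Qed.
Lemma scalar_center_prod (I : Type) (s : seq I) (P : pred I) (F : I -> k) :
  scalar_center (\prod_(i <- s | P i) F i) =
  \prod_(i <- s | P i) scalar_center (F i).
Proof. exact: rmorph_prod. Qed.

Definition kappa (z : center A) : {poly {poly k}} := pcoef D (\val z).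

Lemma kappa_zmod_morphism : zmod_morphism kappa.
Proof. by move=> z w; rewrite /kappa (raddfB val) raddfB. Qed.

HB.instance Definition _ :=
  GRing.isZmodMorphism.Build (center A) {poly {poly k}} kappa
    kappa_zmod_morphism.

Lemma kappa_monoid_morphism : monoid_morphism kappa.
Proof.
split=> [|z w]; first exact: pcoef1.
by rewrite /kappa rmorphM /= pcoef_centralMl // => a; apply: centerC.
Qed.

HB.instance Definition _ :=
  GRing.isMonoidMorphism.Build (center A) {poly {poly k}} kappa
    kappa_monoid_morphism.

Lemma kappa_inj : injective kappa.
Proof. by move=> z w /pcoef_inj /val_inj. Qed.

Lemma kappa0 : kappa 0 = 0. Proof. exact: rmorph0. Qed.
Lemma kappa1 : kappa 1 = 1. Proof. exact: rmorph1. Qed.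
Lemma kappaB : {morph kappa : z w / z - w}. Proof. exact: rmorphB. Qed.
Lemma kappaM : {morph kappa : z w / z * w}. Proof. exact: rmorphM. Qed.
Lemma kappaX m : {morph kappa : z / z ^+ m}. Proof. exact: rmorphXn. Qed.

Lemma kappa_scalar c : kappa (scalar_center c) = c%:P%:P.
Proof. by rewrite /kappa /= pcoefZ pcoef1 alg_polyC. Qed.

Lemma scaler_center (z : center A) (a : over_center A) :
  z *: a = \val z * a :> A.
Proof. by []. Qed.

End CenterMap.

(** [kappa] is a ring morphism into k[x, y], and over a domain the units of a polynomial ring are
    constant; this is used once for each variable. *)
Lemma kappa_unit (k : idomainType) (q : k) (A : algType k) (x y : A)
    (D : pbw_data q x y) (z w : center A) :
  z * w = 1 -> exists2 c : k, c \is a GRing.unit & kappa D z = c%:P%:P.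
Proof.
move=> zw1; have uz : kappa D z \is a GRing.unit.
  apply/unitrPr; exists (kappa D w); by rewrite -rmorphM zw1 rmorph1.
move: uz; rewrite poly_unitE => /andP[/size_poly1P[u u_neq0 ->]].
rewrite coefC eqxx poly_unitE => /andP[/size_poly1P[c c_neq0 ->]].
by rewrite coefC eqxx => uc; exists c.
Qed.

Section Root.
Variables (k : idomainType) (n : nat) (q : k).
Hypotheses (n_ge2 : (2 <= n)%N) (q_prim : n.-primitive_root q).

Lemma prim_root_neq1 : q != 1.
Proof. by rewrite -(expr1 q) -(prim_order_dvd q_prim) dvdn1 gtn_eqF. Qed.

Lemma subr1_qnat i : (1 - q) * qnat q i = 1 - q ^+ i.
Proof. by rewrite -[RHS]opprB subrX1 -mulNr opprB. Qed.

(** Since (1 - q) [i]_q = 1 - q^i and 1 - q is a nonzero element of a domain, this is the order of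
    q. *)
Lemma qnat_eq0 i : (qnat q i == 0) = (n %| i)%N.
Proof.
rewrite (prim_order_dvd q_prim) [RHS]eq_sym -[RHS]subr_eq0 -subr1_qnat.
by rewrite mulf_eq0 subr_eq0 [1 == q]eq_sym (negPf prim_root_neq1).
Qed.

End Root.

Section Center.
Variables (k : idomainType) (n : nat) (q : k) (A : algType k) (x y : A).
Hypotheses (n_ge2 : (2 <= n)%N) (q_prim : n.-primitive_root q).
Variable D : pbw_data q x y.
Local Notation kappa := (kappa D).

Let n_gt0 : (0 < n)%N. Proof. exact: leq_trans n_ge2. Qed.

Lemma qnat_prim_order : qnat q n = 0.
Proof. by apply/eqP; rewrite (qnat_eq0 n_ge2 q_prim). Qed.

(** Only y has to be checked, and both corrections in [y_xn] disappear because q^n = 1 and [n]_q =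
    0. *)
Lemma xn_central a : x ^+ n * a = a * x ^+ n.
Proof.
apply: (commute_gen D); first by rewrite -exprSr exprS.
rewrite (y_xn D) (prim_expr_order q_prim) scale1r.
by rewrite qnat_prim_order scale0r addr0.
Qed.

Lemma yn_central a : y ^+ n * a = a * y ^+ n.
Proof.
apply: (commute_gen D); last by rewrite -exprSr exprS.
rewrite (yn_x D) (prim_expr_order q_prim) scale1r.
by rewrite qnat_prim_order scale0r addr0.
Qed.

(* Comparing coefficients in zy = yz and in zx = xz gives, by induction on i,
   [i]_q z_ij = 0 and [j]_q z_ij = 0. *)
Lemma kappa_supp (z : center A) i j :
  (kappa z)`_i`_j != 0 -> (n %| i)%N && (n %| j)%N.
Proof.
have zC := centerC z; rewrite /kappa; set p := pcoef D _ => p_neq0.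
have pi0 m : qnat q m *: p`_m = 0.
  elim: m => [|m IH]; first by rewrite qnat0 scale0r.
  have /(congr1 (fun r : {poly {poly k}} => r`_m)) :
    pcoef D (\val z * y) = pcoef D (y * \val z) by rewrite zC.
  rewrite pcoef_yMr pcoef_yMl coefZ coef_yact -/p => /eqP.
  rewrite -subr_eq0 opprD addrA subr_eq0 => /eqP <-.
  (* Here [m+1]_q z_(m+1) = (1 - q^m) t z_m, with t the inner variable, and 1 - q^m = (1 - q) [m]_q,
     so the induction hypothesis applies. *)
  by rewrite -{1}['X * _]scale1r -scalerBl -subr1_qnat -scalerA scalerAr IH mulr0 scaler0.
have pj0 m : forall l, qnat q l * p`_m`_l = 0.
  elim: m => [|m IH] [|l]; rewrite ?qnat0 ?mul0r //.
    (* x z has no term free of x, so at x^0 the identity z x = x z leaves only [l+1]_q z_(0,l+1) =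
       0. The inductive case reads [l+1]_q z_(m+1,l+1) = (1 - q^l) z_(m,l). *)
    have /(congr1 (fun r : {poly {poly k}} => r`_0`_l)) :
      pcoef D (\val z * x) = pcoef D (x * \val z) by rewrite zC.
    by rewrite coef_pcoef_xMr // add0r pcoef_xMl coefXM /= coef0.
  have /(congr1 (fun r : {poly {poly k}} => r`_m.+1`_l)) :
    pcoef D (\val z * x) = pcoef D (x * \val z) by rewrite zC.
  rewrite coef_pcoef_xMr // pcoef_xMl coefXM /= -/p => /eqP.
  rewrite addrC -subr_eq0 -addrA addr_eq0 opprB => /eqP ->.
  by rewrite -{1}[p`_m`_l]mul1r -mulrBl -subr1_qnat -mulrA IH mulr0.
rewrite -!(qnat_eq0 n_ge2 q_prim); apply/andP; split.
  have /(congr1 (fun r : {poly k} => r`_j)) := pi0 i.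
  by rewrite coefZ coef0 => /eqP; rewrite mulf_eq0 (negPf p_neq0) orbF.
by have /eqP := pj0 i j; rewrite mulf_eq0 (negPf p_neq0) orbF.
Qed.

Definition xn_center : center A := in_center xn_central.
Definition yn_center : center A := in_center yn_central.

Lemma kappa_xn : kappa xn_center = 'X^n.
Proof. by rewrite /kappa /= -[x ^+ n]mulr1 pcoef_xnMl pcoef1 mulr1. Qed.

Definition pbw_basis (ij : 'I_n * 'I_n) : over_center A :=
  x ^+ ij.1 * y ^+ ij.2.

Lemma pbw_basis_gen a : exists c : {ffun 'I_n * 'I_n -> center A},
  a = \sum_ij c ij *: pbw_basis ij.
Proof.
rewrite [a](pbw_expand D).
have S0 : exists c : {ffun 'I_n * 'I_n -> center A},
    0 = \sum_ij c ij *: pbw_basis ij.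
  by exists [ffun=> 0]; rewrite big1 // => ij _; rewrite ffunE scale0r.
have SD (a1 a2 : over_center A) :
    (exists c : {ffun 'I_n * 'I_n -> center A},
       a1 = \sum_ij c ij *: pbw_basis ij) ->
    (exists c : {ffun 'I_n * 'I_n -> center A},
       a2 = \sum_ij c ij *: pbw_basis ij) ->
    exists c : {ffun 'I_n * 'I_n -> center A},
      a1 + a2 = \sum_ij c ij *: pbw_basis ij.
  move=> [c1 ->] [c2 ->]; exists [ffun ij => c1 ij + c2 ij].
  by rewrite -big_split; apply: eq_bigr => ij _; rewrite ffunE scalerDl.
suff monoC c s t : exists z : {ffun 'I_n * 'I_n -> center A},
    c *: (x ^+ s * y ^+ t) = \sum_ij z ij *: pbw_basis ij.
  by elim/big_ind: _ => // i _; elim/big_ind: _ => // j _.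
(* Dividing both exponents by n splits x^s y^t into central powers of x^n and y^n and a basis
   monomial given by the two remainders. *)
pose st := (Ordinal (ltn_pmod s n_gt0), Ordinal (ltn_pmod t n_gt0)).
exists [ffun ij => scalar_center A c * xn_center ^+ (s %/ n)
  * yn_center ^+ (t %/ n) *+ (ij == st)].
rewrite (bigD1 st) //= big1 => [|ij /negPf ne]; last by rewrite ffunE ne scale0r.
rewrite addr0 ffunE eqxx mulr1n scaler_center !rmorphM !rmorphXn /=.
rewrite /pbw_basis /= -!scalerAl mul1r; congr (_ *: _).
rewrite {1}(divn_eq s n) {1}(divn_eq t n) !exprD !(mulnC _ n) !exprM.
set v := (y ^+ n) ^+ _; set u := (x ^+ n) ^+ _.
have vC b : v * b = b * v.
  by apply: commr_sym; apply: commrX => //; apply/esym/yn_central.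
by rewrite -!mulrA; congr (_ * _); rewrite !mulrA vC.
Qed.

(** By [kappa_supp] the coefficient c (i', j') only involves exponents divisible by n, so its term
    lives in the residue class (i', j') modulo n. A given pair of exponents therefore sees a single
    term. *)
Lemma coef_pbw_sum (c : 'I_n * 'I_n -> center A) s t (i j : 'I_n) :
  (pcoef D (\sum_ij c ij *: pbw_basis ij))`_(s * n + i)`_(t * n + j) =
  (kappa (c (i, j)))`_(s * n)`_(t * n).
Proof.
rewrite raddf_sum /= !coef_sum (bigD1 (i, j)) //= big1 => [|[i' j'] ne].
  rewrite addr0 scaler_center mulrA centerC -mulrA.
  rewrite pcoef_xnMl pcoef_ynMr coefXnM ltnNge leq_addl addnK.
  by rewrite coefZ coefXnM ltnNge leq_addl addnK.
rewrite scaler_center /pbw_basis /= mulrA centerC -mulrA.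
rewrite pcoef_xnMl pcoef_ynMr coefXnM; case: ltnP; rewrite ?coef0 // => le_i'.
rewrite coefZ coefXnM; case: ltnP => // le_j'.
apply/eqP/contraT => /kappa_supp /andP[].
rewrite -!eqn_mod_dvd // !modnMDl !modn_small // => /eqP ei /eqP ej.
by case/eqP: ne; congr pair; apply: val_inj.
Qed.

(** For uniqueness, [coef_pbw_sum] recovers the entries of each [kappa (c ij)] at exponents
    divisible by n, and all other entries vanish. *)
Lemma pbw_basisP : is_basis pbw_basis.
Proof.
move=> a; have [c ac] := pbw_basis_gen a; exists c; split=> // c' ac'.
apply/ffunP => -[i j]; apply: (@kappa_inj _ _ _ _ _ D).
apply/polyP => s; apply/polyP => t.
have [/andP[/dvdnP[s' ->] /dvdnP[t' ->]]|ndiv] :=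
    boolP ((n %| s)%N && (n %| t)%N).
  by rewrite -!coef_pbw_sum -ac -ac'.
have supp0 z : (kappa z)`_s`_t = 0.
  by apply/eqP; apply: contraNT ndiv; apply: kappa_supp.
by rewrite !supp0.
Qed.

End Center.

(** * Traces and Gram matrices *)

Section Basis.
Variables (Z : comNzRingType) (A : algType Z).

(** Uniqueness of coordinates for plain functions, freed from the finite functions in [is_basis]. *)
Lemma is_basis_free (I : finType) (b : I -> A) (c c' : I -> Z) :
  is_basis b -> \sum_i c i *: b i = \sum_i c' i *: b i -> c =1 c'.
Proof.
move=> bP cc'; have [d [_ dU]] := bP (\sum_i c i *: b i).
have fE (e : I -> Z) : \sum_i e i *: b i = \sum_i [ffun i => e i] i *: b i.
  by apply: eq_bigr => i _; rewrite ffunE.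
have ec : d = [ffun i => c i] by apply: dU; exact: fE.
have ec' : d = [ffun i => c' i] by apply: dU; rewrite cc'; exact: fE.
move=> i; have /ffunP/(_ i) := etrans (esym ec) ec'.
by rewrite !ffunE.
Qed.

Lemma is_basis_bij (I J : finType) (b : I -> A) (f : J -> I) :
  bijective f -> is_basis b -> is_basis (b \o f).
Proof.
move=> fB bP a; have [g fK gK] := fB; have [c [ac cU]] := bP a.
exists [ffun j => c (f j)]; split=> [|c' ac'].
  rewrite ac (reindex f) /=; last exact: onW_bij.
  by apply: eq_bigr => j _; rewrite ffunE.
apply/ffunP => j; rewrite ffunE (cU [ffun i => c' (g i)]) ?ffunE ?fK //.
rewrite ac' [RHS](reindex f) /=; last exact: onW_bij.
by apply: eq_bigr => i _; rewrite ffunE fK.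
Qed.

Section Trace.
Variables (r : nat) (b : 'I_r -> A).
Hypothesis bP : is_basis b.

Lemma coords_sum a : a = \sum_i coords b a i *: b i.
Proof.
have [c [ac _]] := bP a.
exact: (@xgetPex _ _ [set c : {ffun _} | a = \sum_i c i *: b i]%classic
  (ex_intro _ c ac)).
Qed.

Lemma coordsP (c : 'I_r -> Z) i : coords b (\sum_i c i *: b i) i = c i.
Proof. by apply: (is_basis_free bP); rewrite -coords_sum. Qed.

Lemma coords_linear z u v i :
  coords b (z *: u + v) i = z * coords b u i + coords b v i.
Proof.
rewrite -[RHS](coordsP (fun i => z * coords b u i + coords b v i)).
congr (coords b _ _); rewrite {1}[u]coords_sum {1}[v]coords_sum scaler_sumr.
rewrite -big_split; apply: eq_bigr => j _.
by rewrite scalerDl scalerA.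
Qed.

Lemma algtr_is_linear : scalar (algtr b).
Proof.
move=> z u v; rewrite /algtr -mxtraceZ -mxtraceD; congr (\tr _).
by apply/matrixP => i j; rewrite !mxE mulrDl -scalerAl coords_linear.
Qed.

HB.instance Definition _ :=
  GRing.isLinear.Build Z A Z _ (algtr b) algtr_is_linear.

Lemma algtrZ z u : algtr b (z *: u) = z * algtr b u.
Proof. by rewrite linearZ. Qed.

Lemma lmul_mxM u v : lmul_mx b (u * v) = lmul_mx b u *m lmul_mx b v.
Proof.
apply/matrixP => i j; rewrite !mxE.
rewrite -[RHS](coordsP (fun i => \sum_l lmul_mx b u i l * lmul_mx b v l j)).
congr (coords b _ _); rewrite -mulrA {1}[v * b j]coords_sum mulr_sumr.
under eq_bigr => l _ do rewrite -scalerAr [u * b l]coords_sum scaler_sumr.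
rewrite exchange_big /=; apply: eq_bigr => l _; rewrite scaler_suml.
by apply: eq_bigr => m _; rewrite !mxE scalerA mulrC.
Qed.

Lemma algtrMC u v : algtr b (u * v) = algtr b (v * u).
Proof. by rewrite /algtr !lmul_mxM mxtrace_mulC. Qed.

Lemma algtr1 : algtr b 1 = r%:R.
Proof.
rewrite /algtr (_ : lmul_mx b 1 = 1%:M) ?mxtrace1 //.
apply/matrixP => i j; rewrite !mxE mul1r.
rewrite -(coordsP (fun i => (i == j)%:R)); congr (coords b _ _).
rewrite (bigD1 j) //= eqxx scale1r big1 ?addr0 // => l /negPf ->.
by rewrite scale0r.
Qed.

(** The trace stays attached to the basis [b] while [v] is any family, of any length;
    [discriminant b] is the determinant of [gram b b]. *)
Definition gram s (v : 'I_s -> A) : 'M[Z]_s :=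
  \matrix_(i, j) algtr b (v i * v j).

Lemma gram_change s t (U : 'M[Z]_(s, t)) (v : 'I_t -> A) (w : 'I_s -> A) :
  (forall i, w i = \sum_j U i j *: v j) -> gram w = U *m gram v *m U^T.
Proof.
move=> wE; apply/matrixP => i j; rewrite !mxE !wE mulr_suml raddf_sum /=.
under eq_bigr => l _ do rewrite mulr_sumr raddf_sum /=.
rewrite exchange_big; apply: eq_bigr => m _ /=; rewrite mxE mulr_suml.
apply: eq_bigr => l _; rewrite mxE -scalerAl -scalerAr !linearZ /= !mxE.
by rewrite mulrCA mulrC.
Qed.

End Trace.

Definition change_mx r s (b : 'I_r -> A) (b' : 'I_s -> A) : 'M_(r, s) :=
  \matrix_(i, j) coords b' (b i) j.

Lemma change_mxE r s (b : 'I_r -> A) (b' : 'I_s -> A) i :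
  is_basis b' -> b i = \sum_j change_mx b b' i j *: b' j.
Proof.
move=> b'P; rewrite [LHS](coords_sum b'P).
by apply: eq_bigr => j _; rewrite mxE.
Qed.

Lemma change_mxK r s (b : 'I_r -> A) (b' : 'I_s -> A) :
  is_basis b -> is_basis b' -> change_mx b b' *m change_mx b' b = 1%:M.
Proof.
move=> bP b'P; apply/matrixP => i; apply: (is_basis_free bP).
under eq_bigr => l _ do rewrite mxE scaler_suml.
rewrite exchange_big /=.
transitivity (b i); last first.
  rewrite (bigD1 i) //= !mxE eqxx scale1r big1 ?addr0 // => l /negPf ne.
  by rewrite !mxE eq_sym ne scale0r.
rewrite [RHS](change_mxE b i b'P); apply: eq_bigr => m _.
rewrite [in RHS](change_mxE b' m bP) scaler_sumr; apply: eq_bigr => l _.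
by rewrite scalerA.
Qed.

(** The two change of basis matrices are mutually inverse, which over a nonzero commutative ring
    forces them to be square. *)
Lemma is_basis_rank r s (b : 'I_r -> A) (b' : 'I_s -> A) :
  is_basis b -> is_basis b' -> r = s.
Proof.
move=> bP b'P; apply/eqP; rewrite eqn_leq.
by rewrite (mulmx1_min (change_mxK bP b'P)) (mulmx1_min (change_mxK b'P bP)).
Qed.

(** The factor u is the determinant of the matrix expressing b' in b. Its invertibility is stated
    through an explicit inverse, the form that [kappa_unit] accepts. *)
Lemma det_gram_basis r (b b' : 'I_r -> A) :
  is_basis b -> is_basis b' -> exists u u' : Z,
    u * u' = 1 /\ \det (gram b b') = u ^+ 2 * discriminant b.
Proof.
move=> bP b'P; exists (\det (change_mx b' b)), (\det (change_mx b b')).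
split; first by rewrite -det_mulmx change_mxK // det1.
rewrite (gram_change bP (U := change_mx b' b) (v := b)); last first.
  by move=> i; apply: change_mxE.
by rewrite !det_mulmx det_tr mulrC mulrA expr2.
Qed.

End Basis.

(** A monomial matrix is a diagonal matrix times a permutation matrix; e is the parity of the
    permutation. *)
Lemma det_monomial (Z : comNzRingType) r (d : 'I_r -> Z) (f : 'I_r -> 'I_r) :
  injective f -> exists e : bool,
    \det (\matrix_(i, j) (d i *+ (j == f i))) = (-1) ^+ e * \prod_i d i.
Proof.
move=> f_inj; exists (perm f_inj); rewrite mulrC.
have -> : \matrix_(i, j) (d i *+ (j == f i)) =
          diag_mx (\row_i d i) *m perm_mx (perm f_inj).
  by apply/matrixP => i j; rewrite mul_diag_mx !mxE permE mulr_natr eq_sym.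
rewrite det_mulmx det_diag det_perm; congr (_ * _).
by apply: eq_bigr => i _; rewrite mxE.
Qed.

(** * Roots of unity and indexing *)

Section RootProduct.
Variables (k : idomainType) (n : nat) (q : k).
Hypotheses (n_ge2 : (2 <= n)%N) (q_prim : n.-primitive_root q).

Definition root_prod l : {poly k} := \prod_(0 <= i < l) ('X - (q ^+ i)%:P).

Lemma size_root_prod l : size (root_prod l) = l.+1.
Proof. by rewrite size_prod_XsubC size_iota subn0. Qed.

Lemma root_prod_lead l : (root_prod l)`_l = 1.
Proof.
have /monicP := monic_prod_XsubC (index_iota 0 l) xpredT (fun i => q ^+ i).
by rewrite lead_coefE -/(root_prod l) size_root_prod.
Qed.

(** The factorization of X^n - 1 is taken over the fraction field of k, where q stays primitive, and
    pulled back along the injection of polynomial rings. *)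
Lemma root_prod_prim : root_prod n = 'X^n - 1.
Proof.
have tofrac_inj : injective (@tofrac k).
  by move=> a b /eqP; rewrite tofrac_eq => /eqP.
apply: (map_inj_poly tofrac_inj (rmorph0 _)).
have fq_prim : n.-primitive_root (tofrac q).
  apply/andP; split; first exact: prim_order_gt0 q_prim.
  apply/forallP => i; rewrite unity_rootE -rmorphXn -(rmorph1 (@tofrac k)).
  rewrite (inj_eq tofrac_inj) -unity_rootE.
  by case/andP: q_prim => _ /forallP.
rewrite rmorphB rmorph1 /= map_polyXn -(factor_Xn_sub_1 fq_prim) rmorph_prod.
by apply: eq_bigr => i _; rewrite /= map_polyXsubC rmorphXn.
Qed.

(** Evaluate [root_prod_prim] at 0. *)
Lemma prod_oppr_root : \prod_(0 <= i < n) - q ^+ i = -1.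
Proof.
have := congr1 (horner^~ 0) root_prod_prim.
rewrite horner_prod !hornerE expr0n gtn_eqF ?(prim_order_gt0 q_prim) // add0r.
by move=> <-; apply: eq_bigr => i _; rewrite !hornerE.
Qed.

(** Cancel the factor X - 1 on both sides of [root_prod_prim], leaving 1 + X + ... + X^(n-1) on the
    right, and evaluate at 1. *)
Lemma prod_subr1_root : \prod_(1 <= i < n) (1 - q ^+ i) = n%:R.
Proof.
have := root_prod_prim; rewrite /root_prod big_ltn ?(prim_order_gt0 q_prim) //.
rewrite expr0 subrX1 => /mulfI.
rewrite polyXsubC_eq0 => /(_ isT)/(congr1 (horner^~ 1)).
rewrite horner_prod horner_sum => e.
transitivity (\sum_(i < n) ('X^i).[1 : k]).
  by rewrite -e; apply: eq_bigr => i _; rewrite !hornerE.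
under eq_bigr => i _ do rewrite hornerXn expr1n.
by rewrite sumr_const card_ord.
Qed.

(** Each factor 1 - q^i splits as (1 - q) [i]_q. The factor [1]_q is 1, so the remaining product can
    start at 2. *)
Lemma natr_qfact :
  n%:R = (1 - q) ^+ n.-1 * \prod_(2 <= i < n) \sum_(0 <= j < i) q ^+ j.
Proof.
rewrite -prod_subr1_root.
have -> : \prod_(1 <= i < n) (1 - q ^+ i) =
          \prod_(1 <= i < n) ((1 - q) * qnat q i).
  by apply: eq_bigr => i _; rewrite subr1_qnat.
rewrite big_split /= prodr_const_nat subn1; congr (_ * _).
rewrite big_ltn // {1}/qnat big_ord1 expr0 mul1r.
by apply: eq_bigr => i _; rewrite big_mkord.
Qed.

Definition fall_coef l : k := \prod_(0 <= i < l) ((q - 1) * q ^+ i).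

(** Writing (q - 1) q^i as (1 - q) times - q^i and using [prod_oppr_root] gives the sign -1 whatever
    the parity of n. *)
Lemma fall_coef_prim : fall_coef n = - (1 - q) ^+ n.
Proof.
have -> : (1 - q) ^+ n = \prod_(0 <= i < n) (1 - q).
  by rewrite prodr_const_nat subn0.
rewrite -mulrN1 -prod_oppr_root -big_split /=.
by apply: eq_bigr => i _; rewrite mulrN -mulNr opprB.
Qed.

(** Squaring removes the sign between q - 1 and 1 - q; what is left besides powers of 1 - q is a
    power of q, a unit in the application. *)
Lemma fall_coef_sq l :
  fall_coef l ^+ 2 = (\prod_(0 <= i < l) q ^+ i) ^+ 2 * (1 - q) ^+ l.*2.
Proof.
rewrite /fall_coef big_split /= prodr_const_nat subn0 exprMn mulrC.
by rewrite -exprM mulnC exprM -(sqrrN (q - 1)) opprB -exprM mul2n.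
Qed.
End RootProduct.

Lemma sum_double_ord n : (\sum_(j < n) j.*2 = n * n.-1)%N.
Proof.
elim: n => [|n IH]; first by rewrite big_ord0.
rewrite big_ord_recr /= IH; case: n {IH} => // n /=.
by rewrite -muln2 -mulnDr addn2 mulnC.
Qed.

Section RowCol.
Variables (n : nat) (n_gt0 : (0 < n)%N).

Lemma rowcol_subproof (t : 'I_(n * n)) : (t %/ n < n)%N.
Proof. by rewrite ltn_divLR. Qed.

(** Discriminants are indexed by a single ordinal, the families below by pairs. The row-major order
    also makes the change of family in [det_gram_fall_family] triangular. *)
Definition rowcol (t : 'I_(n * n)) : 'I_n * 'I_n :=
  (Ordinal (rowcol_subproof t), Ordinal (ltn_pmod t n_gt0)).

Lemma colrow_subproof (ij : 'I_n * 'I_n) : (ij.1 * n + ij.2 < n * n)%N.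
Proof.
case: ij => i j /=; rewrite (leq_trans (_ : _ < i.+1 * n)%N) ?leq_mul //.
by rewrite mulSn addnC ltn_add2r.
Qed.

Definition colrow ij : 'I_(n * n) := Ordinal (colrow_subproof ij).

Lemma rowcolK : cancel rowcol colrow.
Proof. by move=> t; apply: val_inj; rewrite /= -divn_eq. Qed.

Lemma colrowK : cancel colrow rowcol.
Proof.
move=> [i j]; congr pair; apply: val_inj; rewrite /=.
  by rewrite divnMDl // divn_small ?addn0.
by rewrite modnMDl modn_small.
Qed.

Lemma rowcol_bij : bijective rowcol.
Proof. exact: Bijective rowcolK colrowK. Qed.

Lemma big_rowcol (R : Type) (idx : R) (op : Monoid.com_law idx)
    (F : 'I_n * 'I_n -> R) :
  \big[op/idx]_t F (rowcol t) = \big[op/idx]_i \big[op/idx]_j F (i, j).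
Proof.
rewrite pair_big [RHS](reindex rowcol) /=; last exact/onW_bij/rowcol_bij.
by apply: eq_bigr => t _.
Qed.

Definition mod_ord i : 'I_n := Ordinal (ltn_pmod i n_gt0).

(** The quotient is 0 or 1, and it is 1 exactly for the last i values of j. *)
Lemma sum_div_shift (i : 'I_n) : (\sum_(j < n) (i + j) %/ n = i)%N.
Proof.
transitivity (\sum_(j < n) (n <= i + j))%N.
  apply: eq_bigr => j _; case: leqP => [le_n|lt_n]; last exact: divn_small.
  rewrite -(subnK le_n) divnDr // divnn n_gt0 divn_small //.
  by rewrite ltn_subLR // -addnS leq_add // ltnW.
rewrite -(big_mkord xpredT (fun j => (n <= i + j : nat)))%N.
rewrite (big_cat_nat _ (leq_subr i n)) //= big_nat big1 => [|j].
  rewrite add0n big_nat (eq_bigr (fun => 1%N)) => [|j].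
    by rewrite -big_nat sum_nat_const_nat muln1 subKn // ltnW.
  by rewrite leq_subLR => /andP[-> _].
by move=> /andP[_]; rewrite ltn_subRL ltnNge => /negPf->.
Qed.

(** The quotient is 0 at i = 0, where the residue of n - 0 is 0, and 1 at the other n - 1
    indices. *)
Lemma sum_div_opp : (\sum_(i < n) (i + mod_ord (n - i)) %/ n = n.-1)%N.
Proof.
rewrite (bigD1 (Ordinal n_gt0)) //= subn0 modnn divn_small // add0n.
rewrite (eq_bigr (fun => 1%N)) => [|i i_neq0].
  by rewrite sum1_card cardC1 card_ord.
rewrite modn_small; last first.
  rewrite ltn_subLR; last exact: ltnW.
  by rewrite -[X in (X < _)%N]add0n ltn_add2r lt0n.
by rewrite subnKC ?divnn ?n_gt0 // ltnW.
Qed.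

(** [mod_ord (n - i)] is the residue of -i modulo n. *)
Lemma dvdn_add_opp (i i' : 'I_n) :
  (n %| i + i')%N = (i' == mod_ord (n - i)).
Proof.
rewrite -val_eqE /= -[X in _ = (X == _)](modn_small (ltn_ord i')).
rewrite -(eqn_modDl i) subnKC 1?ltnW // modnn.
by [].
Qed.

End RowCol.

(** * The normal element *)

Section Normal.
Variables (k : idomainType) (q : k) (A : algType k) (x y : A).
Variable D : pbw_data q x y.

(** By the defining relation this is the commutator y x - x y. *)
Definition omega : A := 1 + (q - 1) *: (x * y).
Local Notation om := omega.

Lemma omega_x : om * x = q *: (x * om).
Proof.
rewrite /omega mulrDl mulrDr mul1r mulr1 -!scalerAl -!scalerAr -!mulrA.
rewrite (pbw_rel D) mulrDr mulr1 -scalerAr !scalerDr addrCA.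
rewrite -[X in _ + (X + _)]scale1r -scalerDl [1 + _]addrC subrK addrC.
by rewrite !scalerA [q * _]mulrC.
Qed.

Lemma y_omega : y * om = q *: (om * y).
Proof.
rewrite /omega mulrDl mulrDr mul1r mulr1 -!scalerAl -!scalerAr mulrA.
rewrite (pbw_rel D) mulrDl mul1r -scalerAl !scalerDr addrCA.
rewrite -[X in _ + (X + _)]scale1r -scalerDl [1 + _]addrC subrK addrC.
by rewrite !scalerA [q * _]mulrC.
Qed.

Lemma omega_xn j i : om ^+ j * x ^+ i = q ^+ (j * i) *: (x ^+ i * om ^+ j).
Proof.
have omxn l : om * x ^+ l = q ^+ l *: (x ^+ l * om).
  elim: l => [|l IH]; first by rewrite !expr0 scale1r mulr1 mul1r.
  have -> : om * x ^+ l.+1 = om * x ^+ l * x by rewrite exprSr mulrA.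
  rewrite IH -scalerAl -mulrA omega_x -scalerAr scalerA -exprSr mulrA.
  by rewrite -exprSr.
elim: j => [|j IH]; first by rewrite mul0n !expr0 scale1r mulr1 mul1r.
have -> : om ^+ j.+1 * x ^+ i = om * (om ^+ j * x ^+ i) by rewrite exprS mulrA.
rewrite IH -scalerAr mulrA omxn -scalerAl scalerA -exprD -mulrA -exprS.
by rewrite mulSn addnC.
Qed.

Lemma y_omegan j : y * om ^+ j = q ^+ j *: (om ^+ j * y).
Proof.
elim: j => [|j IH]; first by rewrite !expr0 scale1r mulr1 mul1r.
have -> : y * om ^+ j.+1 = y * om ^+ j * om by rewrite exprSr mulrA.
rewrite IH -scalerAl -mulrA y_omega -scalerAr scalerA -exprSr mulrA.
by rewrite -exprSr.
Qed.

(** A q-analogue of the identity that writes x^l (d/dx)^l as a falling factorial in the Euler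
    operator x d/dx. *)
Lemma omega_falling l :
  fall_coef q l *: (x ^+ l * y ^+ l) = horner_alg om (root_prod q l).
Proof.
elim: l => [|l IH].
  by rewrite /fall_coef /root_prod !big_nil rmorph1 scale1r mulr1.
rewrite /fall_coef /root_prod !big_nat_recr //= -/(fall_coef q l).
rewrite -/(root_prod q l) [root_prod q l * _]mulrC rmorphM /= -IH.
rewrite rmorphB /= horner_algX horner_algC -scalerAr -scalerA.
congr (_ *: _); rewrite [RHS]mulrBl [om * _]mulrA.
(* Moving omega past x^l turns (omega - q^l) x^l y^l into q^l x^l (omega - 1) y^l, and omega - 1 =
   (q - 1) x y. *)
have /= := omega_xn 1 l; rewrite mul1n !expr1 => ->.
rewrite -scalerAl mulr_algl -scalerBr mulrC -scalerA; congr (_ *: _).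
rewrite /omega mulrDr mulr1 mulrDl [x ^+ l * y ^+ l + _]addrC addrK.
by rewrite -scalerAr -scalerAl exprSr exprS !mulrA.
Qed.
End Normal.

Section NormalRoot.
Variables (k : idomainType) (n : nat) (q : k) (A : algType k) (x y : A).
Hypotheses (n_ge2 : (2 <= n)%N) (q_prim : n.-primitive_root q).
Variable D : pbw_data q x y.
Local Notation om := (omega q x y).

Lemma omegan : om ^+ n = 1 - (1 - q) ^+ n *: (x ^+ n * y ^+ n).
Proof.
have := omega_falling D n; rewrite (fall_coef_prim q_prim) (root_prod_prim q_prim).
rewrite rmorphB rmorph1 rmorphXn /= horner_algX scaleNr => /eqP.
by rewrite eq_sym subr_eq addrC => /eqP.
Qed.

Lemma omegan_central a : om ^+ n * a = a * om ^+ n.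
Proof.
apply: (commute_gen D).
  have := omega_xn D n 1; rewrite muln1 expr1 => ->.
  by rewrite (prim_expr_order q_prim) scale1r.
by rewrite (y_omegan D) (prim_expr_order q_prim) scale1r.
Qed.

Definition omegan_center : center A := in_center omegan_central.

(** The constant coefficient of 1 - (1 - q)^n x^n y^n is 1. *)
Lemma kappa_omegan_neq0 : kappa D omegan_center != 0.
Proof.
have n_neq0 : (0 == n)%N = false by rewrite ltn_eqF // (leq_trans _ n_ge2).
apply/eqP => /(congr1 (fun p : {poly {poly k}} => p`_0`_0)).
rewrite /kappa /= omegan raddfB /= pcoef1 !coefB coef_pcoef_monomial n_neq0.
by rewrite !coefC mulr0n subr0 /= => /eqP; rewrite oner_eq0.
Qed.

End NormalRoot.

(** * Traces of the monomials x^i omega^j *)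

Section TraceMonomial.
Variables (k : idomainType) (n : nat) (q : k) (A : algType k) (x y : A).
Hypotheses (n_ge2 : (2 <= n)%N) (q_prim : n.-primitive_root q).
Variable D : pbw_data q x y.
Local Notation om := (omega q x y).
Local Notation S := (scalar_center A).
Local Notation X := (xn_center n_ge2 q_prim D).
Local Notation Om := (omegan_center q_prim D).
Local Notation kappa := (kappa D).

Variables (r : nat) (b : 'I_r -> over_center A).
Hypothesis bP : is_basis b.
Local Notation tr := (algtr b).

Lemma scaler_over c (a : A) : c *: a = S c *: (a : over_center A) :> A.
Proof. by rewrite scaler_center /= mulr_algl. Qed.

(** [kappa] embeds the center into a domain, so nonzero elements of the center can be cancelled. *)
Lemma center_mul_eq0 (z t : center A) : kappa z != 0 -> z * t = 0 -> t = 0.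
Proof.
move=> z_neq0 /(congr1 kappa); rewrite kappaM kappa0 => /eqP.
rewrite mulf_eq0 (negPf z_neq0) /= => /eqP t0.
by apply: (@kappa_inj _ _ _ _ _ D); rewrite kappa0.
Qed.

Lemma center_scalar_eq0 c (t : center A) : c != 1 -> t = S c * t -> t = 0.
Proof.
move=> c_neq1 tE; apply: (@center_mul_eq0 (1 - S c)).
  rewrite kappaB kappa1 kappa_scalar -!polyCB !polyC_eq0.
  by rewrite subr_eq0 eq_sym.
by rewrite mulrBl mul1r -tE subrr.
Qed.

Lemma kappa_xn_neq0 : kappa X != 0.
Proof. by rewrite kappa_xn expf_eq0 polyX_eq0 andbF. Qed.

(** With a = x^i omega^j one has a x = q^j x a, so cyclicity gives tr (a x^n) = q^j tr (a x^n).
    Multiplying by the central x^n, which is cancelled at the end, avoids conjugating by x. *)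
Lemma algtr_xom_omega i j : ~~ (n %| j)%N -> tr (x ^+ i * om ^+ j) = 0.
Proof.
move=> ndiv; set a : A := _ * _.
have ax : a * x = q ^+ j *: (x * a).
  have := omega_xn D j 1; rewrite muln1 expr1 => omx.
  by rewrite /a -mulrA omx -scalerAr !mulrA -exprSr exprS.
have aX : tr (a * x ^+ n) = X * tr a by rewrite -(xn_central n_ge2 q_prim D) -algtrZ.
apply: (center_mul_eq0 kappa_xn_neq0).
apply: (@center_scalar_eq0 (q ^+ j)).
  by rewrite -(prim_order_dvd q_prim).
rewrite -aX -{1}(prednK (prim_order_gt0 q_prim)) exprS mulrA ax.
rewrite -scalerAl scaler_over algtrZ // -mulrA algtrMC // -mulrA -exprSr.
by rewrite (prednK (prim_order_gt0 q_prim)).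
Qed.

(** The same argument with omega^n in place of x^n: here omega a = q^i a omega. *)
Lemma algtr_xom_x i j : ~~ (n %| i)%N -> tr (x ^+ i * om ^+ j) = 0.
Proof.
move=> ndiv; set a : A := _ * _.
have oma : om * a = q ^+ i *: (a * om).
  have := omega_xn D 1 i; rewrite mul1n expr1 => omx.
  by rewrite /a mulrA omx -scalerAl -!mulrA -exprSr exprS.
have aX : tr (om ^+ n * a) = Om * tr a by rewrite -algtrZ.
apply: (center_mul_eq0 (kappa_omegan_neq0 n_ge2 q_prim D)).
apply: (@center_scalar_eq0 (q ^+ i)).
  by rewrite -(prim_order_dvd q_prim).
rewrite -aX -{1}(prednK (prim_order_gt0 q_prim)) exprSr -mulrA oma.
rewrite -scalerAr scaler_over algtrZ // mulrA algtrMC // mulrA -exprS.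
by rewrite (prednK (prim_order_gt0 q_prim)).
Qed.

Lemma algtr_xom_dvd i j :
  tr (x ^+ (n * i) * om ^+ (n * j)) = X ^+ i * Om ^+ j * r%:R.
Proof.
rewrite -(algtr1 bP) -algtrZ // scaler_center rmorphM !rmorphXn /= mulr1.
by rewrite !exprM.
Qed.

End TraceMonomial.

(** * The discriminant *)

Lemma horner_alg_wide (R : comNzRingType) (A : algType R) (a : A) N
    (u : {poly R}) :
  (size u <= N)%N -> horner_alg a u = \sum_(i < N) u`_i *: a ^+ i.
Proof.
move=> le_u_N; have {1}-> : u = \poly_(i < N) u`_i.
  apply/polyP => i; rewrite coef_poly; case: ltnP => // le_N_i.
  by rewrite nth_default // (leq_trans le_u_N).
rewrite poly_def rmorph_sum; apply: eq_bigr => i _ /=.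
by rewrite horner_algZ rmorphXn /= horner_algX.
Qed.

Section Gram.
Variables (k : idomainType) (n : nat) (q : k) (A : algType k) (x y : A).
Hypotheses (n_ge2 : (2 <= n)%N) (q_prim : n.-primitive_root q).
Variable D : pbw_data q x y.
Local Notation om := (omega q x y).
Local Notation S := (scalar_center A).
Local Notation X := (xn_center n_ge2 q_prim D).
Local Notation Om := (omegan_center q_prim D).
Local Notation kappa := (kappa D).

Let n_gt0 : (0 < n)%N. Proof. exact: leq_trans n_ge2. Qed.
Local Notation rowcol := (rowcol n_gt0).
Local Notation mod_ord := (mod_ord n_gt0).

Variable b : 'I_(n * n) -> over_center A.
Hypothesis bP : is_basis b.
Local Notation tr := (algtr b).

Definition om_family (ij : 'I_n * 'I_n) : over_center A :=
  x ^+ ij.1 * om ^+ ij.2.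

Definition fall_family (ij : 'I_n * 'I_n) : over_center A :=
  fall_coef q ij.2 *: (x ^+ (ij.1 + ij.2) * y ^+ ij.2).

(** The trace of x^i omega^j times its only partner, whose exponents i' and j' are the residues of
    -i and -j. The power of q comes from moving omega^j past x^i', and n * n is the trace of 1. *)
Definition gram_entry (ij : 'I_n * 'I_n) : center A :=
  S (q ^+ (ij.2 * mod_ord (n - ij.1)))
  * (X ^+ ((ij.1 + mod_ord (n - ij.1)) %/ n)
     * Om ^+ ((ij.2 + mod_ord (n - ij.2)) %/ n) * (n * n)%:R).

Definition opp_index (t : 'I_(n * n)) : 'I_(n * n) :=
  colrow (mod_ord (n - (rowcol t).1), mod_ord (n - (rowcol t).2)).

Lemma mod_ord_oppK : involutive (fun i : 'I_n => mod_ord (n - i)).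
Proof.
move=> i; apply/esym/eqP; rewrite -dvdn_add_opp addnC.
by rewrite (dvdn_add_opp n_gt0) eqxx.
Qed.

Lemma opp_index_inj : injective opp_index.
Proof.
move=> t t' /(can_inj (colrowK n_gt0)) /eqP; rewrite -pair_eqE.
case/andP=> /eqP/(inv_inj mod_ord_oppK) e1 /eqP/(inv_inj mod_ord_oppK) e2.
apply: (can_inj (rowcolK n_gt0)).
by rewrite [LHS]surjective_pairing [RHS]surjective_pairing e1 e2.
Qed.

Lemma algtr_om_pair ij ij' : tr (om_family ij * om_family ij') =
  gram_entry ij *+ (ij' == (mod_ord (n - ij.1), mod_ord (n - ij.2))).
Proof.
case: ij ij' => i j [i' j'].
have -> : om_family (i, j) * om_family (i', j') =
    S (q ^+ (j * i')) *: (x ^+ (i + i') * om ^+ (j + j') : over_center A).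
  rewrite -scaler_over; pose xom s t : A := x ^+ s * om ^+ t.
  suff : xom i j * xom i' j' = q ^+ (j * i') *: xom (i + i')%N (j + j')%N by [].
  rewrite /xom mulrA -[x ^+ i * _ * _]mulrA.
  by rewrite (omega_xn D) -scalerAr -scalerAl !exprD !mulrA.
(* Being the partner index means that n divides both exponent sums; otherwise one of the two
   vanishing lemmas applies. *)
rewrite (algtrZ bP) -pair_eqE /= -!(dvdn_add_opp n_gt0).
have [div_i|] := boolP (n %| i + i')%N; last first.
  by move=> ndiv; rewrite (algtr_xom_x n_ge2 q_prim D bP _ ndiv) mulr0.
have [div_j|] := boolP (n %| j + j')%N; last first.
  by move=> ndiv; rewrite (algtr_xom_omega n_ge2 q_prim D bP _ ndiv) mulr0.
rewrite -{1}(divnK div_i) -{1}(divnK div_j) !(mulnC _ n).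
rewrite (algtr_xom_dvd n_ge2 q_prim D bP) /gram_entry /= mulr1n.
move: div_i div_j; rewrite !(dvdn_add_opp n_gt0) => /eqP -> /eqP -> /=.
by [].
Qed.

Lemma det_gram_om_family : exists e : bool,
  \det (gram b (om_family \o rowcol)) =
  (-1) ^+ e * \prod_t gram_entry (rowcol t).
Proof.
have [e eE] := det_monomial (gram_entry \o rowcol) opp_index_inj.
exists e; rewrite -eE; congr (\det _); apply/matrixP => t t'; rewrite !mxE /=.
rewrite algtr_om_pair; congr (_ *+ _); rewrite /opp_index.
by rewrite -(inj_eq (can_inj (rowcolK n_gt0)) t') (colrowK n_gt0).
Qed.

Lemma fall_family_om ij :
  fall_family ij =
  \sum_(j < n) S ((root_prod q ij.2)`_j) *: om_family (ij.1, j).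
Proof.
case: ij => i j; rewrite /fall_family /= exprD -mulrA scalerAr.
rewrite (omega_falling D) (@horner_alg_wide _ _ _ n); last first.
  by rewrite size_root_prod.
rewrite mulr_sumr; apply: eq_bigr => l _.
by rewrite -scaler_over -scalerAr.
Qed.

Lemma det_gram_fall_family :
  \det (gram b (fall_family \o rowcol)) = \det (gram b (om_family \o rowcol)).
Proof.
(* E is block diagonal by the power of x. Each block is lower triangular with diagonal 1, since
   [root_prod q l] is monic of degree l. *)
pose E : 'M[center A]_(n * n) := \matrix_(t, t')
  (S ((root_prod q (rowcol t).2)`_(rowcol t').2)
   *+ ((rowcol t').1 == (rowcol t).1)).
rewrite (gram_change bP (U := E) (v := om_family \o rowcol)); last first.
  move=> t; rewrite [LHS]/= fall_family_om.
  under [RHS]eq_bigr => t' _ do rewrite /E mxE /=.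
  rewrite (big_rowcol n_gt0 _ (fun ij =>
    (S (root_prod q (rowcol t).2)`_(ij.2) *+ (ij.1 == (rowcol t).1))
      *: om_family ij)) /=.
  rewrite [RHS](bigD1 (rowcol t).1) //= [X in _ + X]big1 ?addr0.
    by apply: eq_bigr => j _; rewrite eqxx.
  by move=> i /negPf ne; rewrite big1 // => j _; rewrite ne scale0r.
have detE : \det E = 1.
  rewrite det_trig.
    rewrite big1 // => t _; rewrite /E mxE eqxx root_prod_lead.
    by apply: val_inj; rewrite /= scale1r.
  apply/is_trig_mxP => t t' lt_tt'; rewrite /E mxE.
  case: eqP => [e1|]; last by rewrite mulr0n.
  (* Within one block, t < t' puts the power of omega above the degree of the polynomial, where the
     coefficient is 0. *)
  rewrite nth_default ?size_root_prod; last first.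
    move: lt_tt'; rewrite [X in (X < _)%N](divn_eq t n).
    rewrite [X in (_ < X)%N](divn_eq t' n).
    by have /= -> := congr1 val e1; rewrite ltn_add2l.
  by rewrite mulr1n; apply: val_inj; rewrite /= scale0r.
by rewrite !det_mulmx det_tr detE mul1r mulr1.
Qed.

(** The power of [X] appears when the exponent i + j of x reaches n and is reduced modulo n. *)
Definition fall_entry (ij : 'I_n * 'I_n) : center A :=
  S (fall_coef q ij.2) * X ^+ ((ij.1 + ij.2) %/ n).

Definition shift_index (t : 'I_(n * n)) : 'I_(n * n) :=
  colrow (mod_ord ((rowcol t).1 + (rowcol t).2), (rowcol t).2).

Lemma shift_index_inj : injective shift_index.
Proof.
move=> t t' /(can_inj (colrowK n_gt0)) /eqP; rewrite -pair_eqE.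
case/andP=> /= e1 /eqP e2; apply: (can_inj (rowcolK n_gt0)).
rewrite [LHS]surjective_pairing [RHS]surjective_pairing; congr pair => //.
have /= e2' := congr1 val e2; move: e1; rewrite -val_eqE /= -e2' eqn_modDr.
by rewrite !modn_small ?rowcol_subproof // => /eqP e1; apply: val_inj.
Qed.

Lemma fall_family_pbw ij :
  fall_family ij =
  fall_entry ij *: (pbw_basis x y (mod_ord (ij.1 + ij.2), ij.2)).
Proof.
case: ij => i j; rewrite /fall_entry -scalerA -scaler_over /fall_family.
apply: (congr1 (fun a : A => fall_coef q j *: a)).
rewrite scaler_center rmorphXn /pbw_basis /= mulrA.
by rewrite -exprM mulnC -exprD -divn_eq.
Qed.

Lemma det_gram_fall_family_pbw :
  \det (gram b (fall_family \o rowcol)) =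
  (\prod_t fall_entry (rowcol t)) ^+ 2
  * \det (gram b (@pbw_basis k n A x y \o rowcol)).
Proof.
pose N : 'M[center A]_(n * n) := \matrix_(t, t')
  (fall_entry (rowcol t) *+ (t' == shift_index t)).
rewrite (gram_change bP (U := N) (v := @pbw_basis k n A x y \o rowcol)).
  have [e detN] := det_monomial (fall_entry \o rowcol) shift_index_inj.
  rewrite !det_mulmx det_tr detN mulrAC -expr2 exprMn sqrr_sign.
  by rewrite mul1r.
move=> t; rewrite [LHS]/= fall_family_pbw.
rewrite [RHS](bigD1 (shift_index t)) //= big1 ?addr0 => [|t' /negPf ne].
  by rewrite /N mxE eqxx mulr1n /shift_index colrowK.
by rewrite /N mxE ne scale0r.
Qed.

Lemma prod_fall_entry : q \is a GRing.unit -> exists2 c, c \is a GRing.unit &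
  (\prod_t fall_entry (rowcol t)) ^+ 2 =
  S (c * (1 - q) ^+ (n * (n * n.-1))) * X ^+ (n * n.-1).
Proof.
move=> q_unit.
(* The unit collects the powers of q from [fall_coef_sq]. For each i the exponents of 1 - q add up
   to n (n - 1); those of [X] add up to 2i, hence to n (n - 1) over all i. *)
exists (\prod_(i < n) \prod_(j < n) (\prod_(0 <= l < j) q ^+ l) ^+ 2).
  do 2!apply: unitr_prod => ? _; rewrite unitrX // unitr_prod // => l _.
  by rewrite unitrX.
rewrite -prodrXl (big_rowcol n_gt0 _ (fun ij => fall_entry ij ^+ 2)) /=.
have entryE i j : fall_entry (i, j) ^+ 2 =
    S ((\prod_(0 <= l < j) q ^+ l) ^+ 2 * (1 - q) ^+ j.*2)
    * X ^+ ((i + j) %/ n * 2).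
  by rewrite /fall_entry exprMn -scalar_centerX fall_coef_sq -exprM.
under eq_bigr => i _ do under eq_bigr => j _ do rewrite entryE.
under eq_bigr => i _.
  rewrite big_split /= -scalar_center_prod big_split /= -!expr_sum.
  rewrite -big_distrl /= sum_div_shift // sum_double_ord muln2.
  over.
rewrite big_split /= -scalar_center_prod big_split /= -!expr_sum.
by rewrite sum_double_ord sum_nat_const card_ord.
Qed.

(** Each of the n^2 entries contributes a trace of 1, namely n^2, which yields the square of
    n^(n^2). The quotients sum to n - 1 along one index and are repeated n times along the other. *)
Lemma prod_gram_entry : q \is a GRing.unit -> exists2 c, c \is a GRing.unit &
  \prod_t gram_entry (rowcol t) =
  S (c * (n%:R ^+ (n ^ 2)) ^+ 2) * (X ^+ (n * n.-1) * Om ^+ (n * n.-1)).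
Proof.
move=> q_unit; exists (q ^+ (\sum_(i < n) \sum_(j < n) j * ((n - i) %% n))).
  exact: unitrX.
rewrite (big_rowcol n_gt0 _ gram_entry) /=.
under eq_bigr => i _.
  rewrite /gram_entry /= big_split /= -scalar_center_prod.
  rewrite big_split /= big_split /= -!expr_sum prodr_const card_ord.
  rewrite (sum_div_opp n_gt0) sum_nat_const card_ord mulnC.
  over.
rewrite big_split /= -scalar_center_prod.
rewrite big_split /= big_split /= -!expr_sum !sum_nat_const card_ord.
rewrite -big_distrl /= (sum_div_opp n_gt0) [(n.-1 * n)%N]mulnC.
rewrite -scalar_center_nat -scalar_centerX [_ * S (_%:R ^+ _)]mulrC mulrA.
rewrite -scalar_centerM; congr (S (_ * _) * _).
by rewrite natrM -expr2 -!exprM mulnn mulnC.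
Qed.

Lemma discriminant_pbw :
  q \is a GRing.unit ->
  exists2 c, c \is a GRing.unit &
    discriminant b =
    S (c * (n%:R * \prod_(2 <= i < n) \sum_(0 <= j < i) q ^+ j) ^+ (n ^ 2))
    * Om ^+ (n * n.-1).
Proof.
move=> q_unit; set d := discriminant b; set m := \prod_(2 <= i < n) _.
have [e gramE] := det_gram_om_family.
rewrite -det_gram_fall_family det_gram_fall_family_pbw in gramE.
have [u [u' [uu' detE]]] := det_gram_basis bP
  (is_basis_bij (rowcol_bij n_gt0) (pbw_basisP n_ge2 q_prim D)).
have [c1 c1U prod1] := prod_fall_entry q_unit.
have [c2 c2U prod2] := prod_gram_entry q_unit.
(* The change of basis determinant is a unit of the center, hence a scalar that can be absorbed into
   the constant. *)
have [cu cuU kuE] := kappa_unit D uu'.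
have uE : u = S cu by apply: (@kappa_inj _ _ _ _ _ D); rewrite kuE kappa_scalar.
rewrite detE prod1 prod2 -/d uE -scalar_centerX in gramE.
have nE := natr_qfact n_ge2 q_prim; rewrite -/m in nE.
have c0U : c1 * cu ^+ 2 \is a GRing.unit by rewrite unitrM c1U unitrX.
exists ((c1 * cu ^+ 2)^-1 * ((-1) ^+ e * c2)).
  by rewrite unitrM unitrV c0U unitrM c2U unitrX ?unitrN1.
pose w := (1 - q) ^+ (n * (n * n.-1)).
have w_neq0 : w != 0.
  by rewrite expf_neq0 // subr_eq0 eq_sym (prim_root_neq1 n_ge2 q_prim).
have kz_neq0 : kappa (S w * X ^+ (n * n.-1)) != 0.
  rewrite kappaM kappaX kappa_scalar mulf_neq0 ?expf_neq0 ?kappa_xn_neq0 //.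
  by rewrite !polyC_eq0.
(* One of the two factors n^(n^2) in the Gram determinant absorbs w, the power of 1 - q, and becomes
   m^(n^2); the other survives, giving (n m)^(n^2). *)
have nwE : n%:R ^+ (n ^ 2) = w * m ^+ (n ^ 2).
  rewrite {1}nE exprMn -exprM /w; congr (_ ^+ _ * _).
  by rewrite mulnA mulnn mulnC.
(* Neither w nor the power of x^n is assumed invertible, so both sides are multiplied by them and
   compared before cancelling. *)
apply/eqP; rewrite -subr_eq0; apply/eqP.
apply: (center_mul_eq0 kz_neq0).
rewrite mulrBr; apply/eqP; rewrite subr_eq0; apply/eqP.
set c0 := c1 * cu ^+ 2 in c0U *.
have SwE : S w = S c0^-1 * S (c1 * w) * S (cu ^+ 2).
  rewrite -!scalar_centerM; congr S.
  by rewrite -mulrA mulrAC -/c0 mulrA mulVr // mul1r.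
have -> : S w * X ^+ (n * n.-1) * d =
    S c0^-1 * (S (c1 * w) * X ^+ (n * n.-1) * (S (cu ^+ 2) * d)).
  by rewrite [in LHS]SwE; ring.
have sgnE : (-1) ^+ e = S ((-1) ^+ e) by rewrite rmorph_sign.
rewrite gramE sgnE.
have cE : S c0^-1 * S ((-1) ^+ e) * S (c2 * n%:R ^+ (n ^ 2) ^+ 2) =
    S w * S (c0^-1 * ((-1) ^+ e * c2) * (n%:R * m) ^+ (n ^ 2)).
  rewrite -!scalar_centerM; congr S; rewrite expr2 {2}nwE exprMn; ring.
transitivity (S c0^-1 * S ((-1) ^+ e) * S (c2 * n%:R ^+ (n ^ 2) ^+ 2)
  * (X ^+ (n * n.-1) * Om ^+ (n * n.-1))); first by ring.
by rewrite cE; ring.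
Qed.

End Gram.

(** * The quotient algebra A_q as an instance *)

Section QWeylPBW.
Variables (k : comNzRingType) (q : k).

Lemma qact_zmod_morphism : zmod_morphism (fun a : qweyl q => qact a 1).
Proof. by move=> a b; apply/eqP; rewrite eq_sym subr_eq -qactD subrK. Qed.

(** The action is k[t]-linear, and y sends 1 to t. *)
Lemma qact_yMr (a : qweyl q) : qact (a * qweyl_y q) 1 = 'X *: qact a 1.
Proof.
rewrite qactM qact_y -linearZ; congr (qact _ _).
apply/polyP => -[|i]; rewrite coef_yact coefZ !coef1 ?mulr1 ?mulr0 !scaler0 addr0 //.
by rewrite expr0 scale1r.
Qed.

(** Coefficients are read off from the action on 1, since x^i y^j sends 1 to x^i t^j. *)
Definition qweyl_pbw : pbw_data q (qweyl_x q) (qweyl_y q) :=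
  PBWData qact_zmod_morphism (qact1 _ 1) (fun c a => qactZ c a 1)
    (fun a => etrans (qactM _ a 1) (qact_x _ _))
    (fun a => etrans (qactM _ a 1) (qact_y _ _))
    qact_yMr (qweylE q) (@qweyl_ind k q).

End QWeylPBW.

Section Discriminant.
Variables (k : idomainType) (n : nat) (q : k) (A : algType k) (x y : A).
Hypotheses (n_ge2 : (2 <= n)%N) (q_prim : n.-primitive_root q).
Variable D : pbw_data q x y.

Lemma val_discriminant_pbw r (b : 'I_r -> over_center A) :
  q \is a GRing.unit -> is_basis b ->
  exists2 c : k, c \is a GRing.unit &
    \val (discriminant b) =
    (c * (n%:R * \prod_(2 <= i < n) \sum_(0 <= j < i) q ^+ j) ^+ (n ^ 2)) *:
      ((1 - q) ^+ n *: (x ^+ n * y ^+ n) - 1) ^+ (n * (n - 1)).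
Proof.
move=> q_unit bP; have n_gt0 : (0 < n)%N by apply: leq_trans n_ge2.
have rE := is_basis_rank bP
  (is_basis_bij (rowcol_bij n_gt0) (pbw_basisP n_ge2 q_prim D)).
(* Every basis over the center has as many elements as [pbw_basis], so [r] may be taken to be n *
   n. *)
subst r; have [c cU ->] := discriminant_pbw n_ge2 q_prim D bP q_unit.
(* The sign turns powers of 1 - (1 - q)^n x^n y^n into powers of (1 - q)^n x^n y^n - 1. *)
exists (c * (-1) ^+ (n * n.-1)); first by rewrite unitrM cU unitrX ?unitrN1.
rewrite subn1 rmorphM rmorphXn /= (omegan q_prim D) -opprB (exprNn (_ - 1)).
rewrite mulr_algl -[in LHS]signr_odd mulr_sign -scaler_sign signr_odd scalerA.
by rewrite mulrAC.
Qed.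

End Discriminant.

Theorem theorem0p1 (k : idomainType) (n : nat) (q : k)
    (n_ge2 : (2 <= n)%N) (q_unit : q \is a GRing.unit)
    (q_prim : n.-primitive_root q) :
  let A := over_center (qweyl q) in
  let x : qweyl q := qweyl_x q in
  let y : qweyl q := qweyl_y q in
  let m : k := \prod_(2 <= i < n) \sum_(0 <= j < i) q ^+ j in
  is_basis (fun ij : 'I_n * 'I_n => x ^+ ij.1 * y ^+ ij.2 : A) /\
  forall (r : nat) (b : 'I_r -> A), is_basis b ->
    exists2 c : k, c \is a GRing.unit &
      \val (discriminant b) =
        (c * (n%:R * m) ^+ (n ^ 2)) *:
          ((1 - q) ^+ n *: (x ^+ n * y ^+ n) - 1) ^+ (n * (n - 1)) :> qweyl q.
Proof.
split; first exact: (pbw_basisP n_ge2 q_prim (qweyl_pbw q)).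
by move=> r b; apply: (val_discriminant_pbw n_ge2 q_prim (qweyl_pbw q)).
Qed.
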